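(* Let $A\in\mathbb{R}^{n_x\times n_x}$, $B\in\mathbb{R}^{n_x\times n_u}$, and let $Q\in\mathbb{R}^{n_x\times n_x}$, $R\in\mathbb{R}^{n_u\times n_u}$ be symmetric positive definite, with $(A,B)$ stabilizable. Let $\mathcal{K}=\{K\in\mathbb{R}^{n_u\times n_x}:\rho(A-BK)<1\}$, for $K\in\mathcal{K}$ let $$J(K)=\sup_{\omega\in[0,2\pi]}\lambda_{\max}^{1/2}\Big((e^{-j\omega}I-A+BK)^{-\mathsf{T}}(Q+K^{\mathsf{T}}RK)(e^{j\omega}I-A+BK)^{-1}\Big),$$ and $J^*=\min_{K\in\mathcal{K}}J(K)$. Let $K^0\in\mathcal{K}$ and $\Delta_0:=\mathrm{dist}(\mathcal{K}_{J(K^0)},\mathcal{K}^c)>0$. Fix any $\delta<\Delta_0$ and run Goldstein's subgradient method $K^{n+1}=K^n-\delta F^n/\|F^n\|_F$, where $F^n$ is the minimum-norm element of $\partial_\delta J(K^n)$. Then $K^n\in\mathcal{K}$ for all $n$, and for every $N$, $$\min_{0\le n\le N}\|F^n\|_F\le\frac{J(K^0)-J^*}{(N+1)\delta}.$$ In particular, with $\Delta:=J(K^0)-J^*$, for any $\delta<\Delta_0$ and $\epsilon>0$ one has $\min_{0\le n\le N}\|F^n\|_F\le\epsilon$ after $N=\mathcal{O}\big(\frac{\Delta}{\delta\epsilon}\big)$ iterations, i.e. a $(\delta,\epsilon)$-stationary point is found within $\mathcal{O}\big(\frac{\Delta}{\delta\epsilon}\big)$ iterations.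
   Context: $\rho(\cdot)$ denotes spectral radius, $j=\sqrt{-1}$, $\lambda_{\max}$ the largest eigenvalue of a Hermitian matrix, $\|\cdot\|_F$ the Frobenius norm, $\mathcal{K}^c$ the complement of $\mathcal{K}$, $\mathcal{K}_\gamma=\{K\in\mathcal{K}:J(K)\le\gamma\}$, $\mathrm{dist}$ the Frobenius-norm distance between sets. $J$ is locally Lipschitz on $\mathcal{K}$. The Clarke subdifferential is $\partial_CJ(K)=\mathrm{conv}\{\lim_i\nabla J(K_i):K_i\to K,\ K_i\text{ differentiability points of }J\}$; for $\mathbb{B}_\delta(K)\subset\mathcal{K}$ the Goldstein subdifferential is $\partial_\delta J(K)=\mathrm{conv}\big(\bigcup_{K'\in\mathbb{B}_\delta(K)}\partial_CJ(K')\big)$. A point $K$ is $(\delta,\epsilon)$-stationary if $\mathrm{dist}(0,\partial_\delta J(K))\le\epsilon$. *)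

(* Defs.v *)
From HB Require Import structures.
From mathcomp Require Import all_boot all_order all_algebra.
From mathcomp Require Import complex.
From mathcomp Require Import all_classical all_reals all_analysis.
Set Implicit Arguments. Unset Strict Implicit. Unset Printing Implicit Defensive.
Import Order.TTheory GRing.Theory Num.Theory.
Local Open Scope ring_scope.
Local Open Scope classical_set_scope.

Section Defs.
Variable R : realType.

Definition cmx m n (M : 'M[R]_(m, n)) : 'M[R[i]]_(m, n) :=
  map_mx (fun x => (x%:C)%C) M.

Definition spectral_radius n (M : 'M[R]_n) : R :=
  sup [set Normc.normc z | z in [set z : R[i] | eigenvalue (cmx M) z]].

(* largest eigenvalue of a Hermitian complex matrix (its eigenvalues are real) *)
Definition lambda_max n (M : 'M[R[i]]_n) : R :=
  sup [set complex.Re z | z in [set z : R[i] | eigenvalue M z]].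

Definition sym_posdef n (M : 'M[R]_n) : Prop :=
  M^T = M /\ forall x : 'rV[R]_n, x != 0 -> 0 < (x *m M *m x^T) 0 0.

Definition frob_dot m n (M N : 'M[R]_(m, n)) : R :=
  \sum_(i < m) \sum_(j < n) M i j * N i j.
Definition frob m n (M : 'M[R]_(m, n)) : R := Num.sqrt (frob_dot M M).

Definition stab_set nx nu (A : 'M[R]_nx) (B : 'M[R]_(nx, nu))
  : set 'M[R]_(nu, nx) := [set K | spectral_radius (A - B *m K) < 1].

Definition stabilizable nx nu (A : 'M[R]_nx) (B : 'M[R]_(nx, nu)) : Prop :=
  exists K, stab_set A B K.

Definition expj (w : R) : R[i] := (Complex (cos w) (sin w))%C.

Definition Hinf_cost nx nu (A : 'M[R]_nx) (B : 'M[R]_(nx, nu))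
  (Q : 'M[R]_nx) (Rm : 'M[R]_nu) (K : 'M[R]_(nu, nx)) : R :=
  sup [set Num.sqrt (lambda_max
        ((invmx ((expj (- w))%:M - cmx A + cmx B *m cmx K))^T
         *m cmx (Q + K^T *m Rm *m K)
         *m invmx ((expj w)%:M - cmx A + cmx B *m cmx K)))
      | w in `[0, 2 * pi]%classic].

Definition sublevel nu nx (S : set 'M[R]_(nu, nx)) (J : 'M[R]_(nu, nx) -> R)
  (gamma : R) : set 'M[R]_(nu, nx) := [set K | S K /\ J K <= gamma].

(* Frobenius distance between sets (extended real; +oo if a set is empty) *)
Definition set_dist m n (S1 S2 : set 'M[R]_(m, n)) : \bar R :=
  ereal_inf [set x | exists K1 K2, S1 K1 /\ S2 K2 /\ x = (frob (K1 - K2))%:E].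

Definition has_gradient m n (J : 'M[R]_(m, n) -> R) (K G : 'M[R]_(m, n)) : Prop :=
  forall e : R, 0 < e -> exists d : R, 0 < d /\
    forall H : 'M[R]_(m, n), frob H < d ->
      `|J (K + H) - J K - frob_dot G H| <= e * frob H.

Definition mx_conv m n (u : nat -> 'M[R]_(m, n)) (l : 'M[R]_(m, n)) : Prop :=
  forall e : R, 0 < e -> exists N : nat, forall k, (N <= k)%N -> frob (u k - l) < e.

Definition conv_hull m n (S : set 'M[R]_(m, n)) : set 'M[R]_(m, n) :=
  [set G | exists (p : nat) (w : 'I_p -> R) (X : 'I_p -> 'M[R]_(m, n)),
     (forall i, 0 <= w i) /\ \sum_(i < p) w i = 1 /\ (forall i, S (X i)) /\
     G = \sum_(i < p) w i *: X i].

Definition clarke_subdiff m n (J : 'M[R]_(m, n) -> R) (K : 'M[R]_(m, n))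
  : set 'M[R]_(m, n) :=
  conv_hull [set G | exists (Ks Gs : nat -> 'M[R]_(m, n)),
     (forall k, has_gradient J (Ks k) (Gs k)) /\ mx_conv Ks K /\ mx_conv Gs G].

Definition frob_ball m n (K : 'M[R]_(m, n)) (d : R) : set 'M[R]_(m, n) :=
  [set K' | frob (K' - K) <= d].

Definition goldstein_subdiff m n (J : 'M[R]_(m, n) -> R) (d : R) (K : 'M[R]_(m, n))
  : set 'M[R]_(m, n) :=
  conv_hull (\bigcup_(K' in frob_ball K d) clarke_subdiff J K').

Definition min_norm_elt m n (S : set 'M[R]_(m, n)) (F : 'M[R]_(m, n)) : Prop :=
  S F /\ forall G, S G -> frob F <= frob G.

Definition stationary m n (J : 'M[R]_(m, n) -> R) (d e : R) (K : 'M[R]_(m, n))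
  : Prop := inf [set frob G | G in goldstein_subdiff J d K] <= e.

End Defs.

(* Main.v *)
Require Import Defs.
From HB Require Import structures.
From mathcomp Require Import all_boot all_order all_algebra.
From mathcomp Require Import complex.
From mathcomp Require Import all_classical all_reals all_analysis.
From mathcomp Require Import ring lra.
Import Order.TTheory GRing.Theory Num.Theory.
Import numFieldNormedType.Exports.
Local Open Scope ring_scope.
Local Open Scope classical_set_scope.

Set Implicit Arguments.
Unset Strict Implicit.
Unset Printing Implicit Defensive.

(** J(K)^2 is the maximum over frequencies w and complex vectors x <> 0 of the
    quotient x^*(Q + K^T R K)x / |(e^(iw) - A + BK)x|^2, whose numerator and
    denominator are polynomials in K.  A quotient active at K touches J from
    below, so J is differentiable at K as soon as a quadratic touches it from
    above there.  This makes Rademacher's theorem unnecessary: if one Goldstein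
    step along v failed to decrease J by delta |F|, then J minus a suitable
    smooth penalty would attain its maximum inside the ball of radius delta, at a point
    where J is touched from above with a gradient G such that <G, v> > - |F|.
    But G lies in the Goldstein subdifferential, hence <G, F> >= |F|^2 because F
    is its element of minimal norm.  Summing the decrease gives the rate. *)

(** * Frobenius inner product and norm *)

Section FrobeniusInnerProduct.
Variable R : realType.
Implicit Types m n p : nat.

Lemma frob_dot_tr m n (X Y : 'M[R]_(m, n)) : frob_dot X Y = \tr (X^T *m Y).
Proof.
rewrite /frob_dot exchange_big /mxtrace; apply: eq_bigr => j _.
by rewrite mxE; apply: eq_bigr => i _; rewrite mxE.
Qed.

Lemma frob_dotC m n (X Y : 'M[R]_(m, n)) : frob_dot X Y = frob_dot Y X.
Proof. by do 2!apply: eq_bigr => ? _; rewrite mulrC. Qed.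

Lemma frob_dotDr m n (X Y Z : 'M[R]_(m, n)) :
  frob_dot X (Y + Z) = frob_dot X Y + frob_dot X Z.
Proof. by rewrite !frob_dot_tr mulmxDr mxtraceD. Qed.

Lemma frob_dotZr m n (X Y : 'M[R]_(m, n)) a :
  frob_dot X (a *: Y) = a * frob_dot X Y.
Proof. by rewrite !frob_dot_tr -scalemxAr mxtraceZ. Qed.

Lemma frob_dotNr m n (X Y : 'M[R]_(m, n)) :
  frob_dot X (- Y) = - frob_dot X Y.
Proof. by rewrite -scaleN1r frob_dotZr mulN1r. Qed.

Lemma frob_dotDl m n (X Y Z : 'M[R]_(m, n)) :
  frob_dot (X + Y) Z = frob_dot X Z + frob_dot Y Z.
Proof. by rewrite frob_dotC frob_dotDr !(frob_dotC Z). Qed.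

Lemma frob_dotZl m n (X Y : 'M[R]_(m, n)) a :
  frob_dot (a *: X) Y = a * frob_dot X Y.
Proof. by rewrite frob_dotC frob_dotZr frob_dotC. Qed.

Lemma frob_dotNl m n (X Y : 'M[R]_(m, n)) :
  frob_dot (- X) Y = - frob_dot X Y.
Proof. by rewrite frob_dotC frob_dotNr frob_dotC. Qed.

Lemma frob_dot0r m n (X : 'M[R]_(m, n)) : frob_dot X 0 = 0.
Proof. by rewrite frob_dot_tr mulmx0 mxtrace0. Qed.

Lemma frob_dot0l m n (X : 'M[R]_(m, n)) : frob_dot 0 X = 0.
Proof. by rewrite frob_dotC frob_dot0r. Qed.

Definition frob_dotE := (frob_dotDr, frob_dotDl, frob_dotZr, frob_dotZl,
  frob_dotNr, frob_dotNl, frob_dot0r, frob_dot0l).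

Lemma frob_dot_mulmxl m n p (M : 'M[R]_(p, m)) (X : 'M[R]_(m, n)) Y :
  frob_dot (M *m X) Y = frob_dot X (M^T *m Y).
Proof. by rewrite !frob_dot_tr trmx_mul mulmxA. Qed.

Lemma frob_dot_mulmxr m n p (M : 'M[R]_(n, p)) (X : 'M[R]_(m, n)) Y :
  frob_dot (X *m M) Y = frob_dot X (Y *m M^T).
Proof. by rewrite !frob_dot_tr trmx_mul -mulmxA mxtrace_mulC mulmxA. Qed.

Lemma frob_dot_ge0 m n (X : 'M[R]_(m, n)) : 0 <= frob_dot X X.
Proof. by do 2!apply: sumr_ge0 => ? _; rewrite -expr2 sqr_ge0. Qed.

Lemma frob_ge0 m n (X : 'M[R]_(m, n)) : 0 <= frob X.
Proof. exact: sqrtr_ge0. Qed.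

Lemma sqr_frob m n (X : 'M[R]_(m, n)) : frob X ^+ 2 = frob_dot X X.
Proof. by rewrite sqr_sqrtr ?frob_dot_ge0. Qed.

Lemma entry_le_frob m n (X : 'M[R]_(m, n)) i j : `|X i j| <= frob X.
Proof.
rewrite -(@ler_sqr _ _ (frob X)) ?nnegrE ?frob_ge0 // sqr_frob.
rewrite real_normK ?num_real // /frob_dot (bigD1 i) //= (bigD1 j) //= -expr2.
rewrite -addrA lerDl addr_ge0 //.
  by apply: sumr_ge0 => ? _; rewrite -expr2 sqr_ge0.
by do 2!apply: sumr_ge0 => ? _; rewrite -expr2 sqr_ge0.
Qed.

Lemma frob_eq0 m n (X : 'M[R]_(m, n)) : (frob X == 0) = (X == 0).
Proof.
apply/eqP/eqP => [X0|->]; last by rewrite /frob frob_dot0r sqrtr0.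
apply/matrixP => i j; apply/eqP; rewrite mxE -normr_le0 -X0.
exact: entry_le_frob.
Qed.

Lemma frob0 m n : frob (0 : 'M[R]_(m, n)) = 0.
Proof. by apply/eqP; rewrite frob_eq0. Qed.

Lemma frob_gt0 m n (X : 'M[R]_(m, n)) : (0 < frob X) = (X != 0).
Proof. by rewrite lt0r frob_eq0 frob_ge0 andbT. Qed.

Lemma frob_dot_gt0 m n (X : 'M[R]_(m, n)) : (0 < frob_dot X X) = (X != 0).
Proof. by rewrite -sqr_frob -frob_gt0 exprn_even_gt0 //= frob_gt0 frob_eq0. Qed.

Lemma frobZ m n (X : 'M[R]_(m, n)) a : frob (a *: X) = `|a| * frob X.
Proof.
by rewrite /frob !frob_dotE mulrA -expr2 sqrtrM ?sqr_ge0 // sqrtr_sqr.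
Qed.

Lemma frobN m n (X : 'M[R]_(m, n)) : frob (- X) = frob X.
Proof. by rewrite -scaleN1r frobZ normrN1 mul1r. Qed.

Lemma cauchy_schwarz m n (X Y : 'M[R]_(m, n)) :
  frob_dot X Y ^+ 2 <= frob_dot X X * frob_dot Y Y.
Proof.
have [->|Y0] := eqVneq Y 0; first by rewrite !frob_dotE expr0n mulr0.
(* This is [frob_dot Y Y] times the component of X orthogonal to Y; its squared norm is
   [frob_dot Y Y] times the Cauchy-Schwarz gap. *)
have := frob_dot_ge0 (frob_dot Y Y *: X - frob_dot X Y *: Y).
rewrite !frob_dotE (frob_dotC Y X); move: Y0; rewrite -frob_dot_gt0.
move: (frob_dot X X) (frob_dot X Y) (frob_dot Y Y) => a b c c0 H.
rewrite -(ler_pM2l c0) -subr_ge0; apply: le_trans H _.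
by rewrite le_eqVlt; apply/orP; left; apply/eqP; ring.
Qed.

Lemma norm_frob_dot m n (X Y : 'M[R]_(m, n)) :
  `|frob_dot X Y| <= frob X * frob Y.
Proof.
rewrite -ler_sqr ?nnegrE ?mulr_ge0 ?frob_ge0 // exprMn !sqr_frob.
by rewrite real_normK ?num_real // cauchy_schwarz.
Qed.

Lemma frobD m n (X Y : 'M[R]_(m, n)) : frob (X + Y) <= frob X + frob Y.
Proof.
rewrite -ler_sqr ?nnegrE ?addr_ge0 ?frob_ge0 // sqrrD !sqr_frob !frob_dotE.
rewrite (frob_dotC Y X); have := norm_frob_dot X Y.
rewrite ler_norml => /andP[_]; lra.
Qed.

(** Each entry of the product pairs a row with a column, so Cauchy-Schwarz applies entry by
    entry. *)
Lemma frob_dot_mulmx_le m n p (X : 'M[R]_(m, n)) (Y : 'M[R]_(n, p)) :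
  frob_dot (X *m Y) (X *m Y) <= frob_dot X X * frob_dot Y Y.
Proof.
rewrite {1 2}/frob_dot mulr_suml; apply: ler_sum => i _.
have -> : frob_dot Y Y = \sum_j \sum_k Y k j * Y k j.
  by rewrite /frob_dot exchange_big.
rewrite mulr_sumr; apply: ler_sum => j _; rewrite -expr2.
have -> : (X *m Y) i j = frob_dot (row i X) (col j Y)^T.
  rewrite mxE /frob_dot big_ord1; apply: eq_bigr => k _.
  by rewrite !mxE.
apply: le_trans (cauchy_schwarz _ _) _.
rewrite /frob_dot !big_ord1 ler_pM //; try by
  apply: sumr_ge0 => k _; rewrite -expr2 sqr_ge0.
  by apply: ler_sum => k _; rewrite !mxE.
by apply: ler_sum => k _; rewrite !mxE.
Qed.

End FrobeniusInnerProduct.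

(** * Convergence, continuity and compactness for matrices *)

Section MatrixTopology.
Variable R : realType.
Implicit Types m n p : nat.

(** Lets continuity be proved along an arbitrary filter, where the convergence lemmas for sums and
    products compose directly. *)
Lemma cvg_continuous (T U : topologicalType) (f : T -> U) (x : T) :
  (forall F : set_system T, Filter F -> t @[t --> F] --> x ->
     f t @[t --> F] --> f x) -> {for x, continuous f}.
Proof. by move=> fx; apply: (fx (nbhs x)); exact: cvg_id. Qed.

Lemma mx_cvg (T : Type) (F : set_system T) m n (f : T -> 'M[R]_(m, n))
    (X : 'M[R]_(m, n)) :
  Filter F -> (forall i j, f t i j @[t --> F] --> X i j) ->
  f t @[t --> F] --> X.
Proof.
move=> FF fX; apply/cvg_ballP => e e0.
have : \forall t \near F, forall i j, ball (X i j) e (f t i j).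
  by do 2!apply: filter_forall => ?; exact: cvg_ball.
by apply: filterS => t fXt; split.
Qed.

Lemma mx_cvg_entry (T : Type) (F : set_system T) m n (f : T -> 'M[R]_(m, n))
    (X : 'M[R]_(m, n))
   i j : Filter F -> f t @[t --> F] --> X -> f t i j @[t --> F] --> X i j.
Proof.
move=> FF fX.
exact: (@cvg_comp _ _ _ f (fun M : 'M[R]_(m, n) => M i j) _ _ _ fX
  (@coord_continuous _ _ _ _ _ _)).
Qed.

Lemma mulmx_cvg (T : Type) (F : set_system T) m n p (f : T -> 'M[R]_(m, n))
    (g : T -> 'M[R]_(n, p)) (X : 'M[R]_(m, n)) (Y : 'M[R]_(n, p)) :
  Filter F -> f t @[t --> F] --> X -> g t @[t --> F] --> Y ->
  f t *m g t @[t --> F] --> X *m Y.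
Proof.
move=> FF fX gY; apply: mx_cvg => i j; rewrite mxE.
under eq_fun do rewrite mxE.
apply: cvg_big => [|k _]; first exact: add_continuous.
by apply: cvgM; exact: mx_cvg_entry.
Qed.

Lemma addmx_cvg (T : Type) (F : set_system T) m n (f g : T -> 'M[R]_(m, n))
    (X Y : 'M[R]_(m, n)) :
  Filter F -> f t @[t --> F] --> X -> g t @[t --> F] --> Y ->
  f t + g t @[t --> F] --> X + Y.
Proof.
move=> FF fX gY; apply: mx_cvg => i j; rewrite mxE.
under eq_fun do rewrite mxE.
by apply: cvgD; exact: mx_cvg_entry.
Qed.

Lemma oppmx_cvg (T : Type) (F : set_system T) m n (f : T -> 'M[R]_(m, n))
    (X : 'M[R]_(m, n)) :
  Filter F -> f t @[t --> F] --> X -> - f t @[t --> F] --> - X.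
Proof.
move=> FF fX; apply: mx_cvg => i j; rewrite mxE.
under eq_fun do rewrite mxE.
by apply: cvgN; exact: mx_cvg_entry.
Qed.

Lemma scalemx_cvg (T : Type) (F : set_system T) m n (f : T -> R)
    (g : T -> 'M[R]_(m, n)) (a : R) (X : 'M[R]_(m, n)) :
  Filter F -> f t @[t --> F] --> a -> g t @[t --> F] --> X ->
  f t *: g t @[t --> F] --> a *: X.
Proof.
move=> FF fa gX; apply: mx_cvg => i j; rewrite mxE.
under eq_fun do rewrite mxE.
by apply: cvgM => //; exact: mx_cvg_entry.
Qed.

Lemma frob_dot_cvg (T : Type) (F : set_system T) m n (f g : T -> 'M[R]_(m, n))
    (X Y : 'M[R]_(m, n)) :
  Filter F -> f t @[t --> F] --> X -> g t @[t --> F] --> Y ->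
  frob_dot (f t) (g t) @[t --> F] --> frob_dot X Y.
Proof.
move=> FF fX gY; apply: cvg_big => [|i _]; first exact: add_continuous.
apply: cvg_big => [|j _]; first exact: add_continuous.
by apply: cvgM; exact: mx_cvg_entry.
Qed.

(** The topology on matrices is entrywise; the Frobenius norm dominates every entry, so Frobenius
    balls fit into neighbourhoods. *)
Lemma near_frob m n (X : 'M[R]_(m, n)) (P : 'M[R]_(m, n) -> Prop) :
  (\forall Y \near X, P Y) ->
  exists2 r : R, 0 < r & forall Y, frob (Y - X) < r -> P Y.
Proof.
move=> /nbhs_ballP[r /= r0 rP]; exists r => // Y YX; apply: rP; split=> // i j.
rewrite /ball /= distrC; apply: le_lt_trans YX.
by have := entry_le_frob (Y - X) i j; rewrite !mxE.
Qed.

Lemma continuous_frob_dotB m n (K X : 'M[R]_(m, n)) :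
  {for X, continuous (fun X : 'M[R]_(m, n) => frob_dot (X - K) (X - K))}.
Proof.
apply: cvg_continuous => F FF FX; have h : (Y - K) @[Y --> F] --> X - K.
  by apply: addmx_cvg => //; exact: cvg_cst.
exact: frob_dot_cvg.
Qed.

Lemma closed_frob_ball m n (K : 'M[R]_(m, n)) d : closed (frob_ball K d).
Proof.
have [d0|d0] := ltP d 0.
  rewrite (_ : frob_ball K d = set0); first exact: closed0.
  by rewrite -subset0 => X /= /le_lt_trans/(_ d0); rewrite ltNge frob_ge0.
rewrite (_ : frob_ball K d =
  (fun X : 'M[R]_(m, n) => frob_dot (X - K) (X - K)) @^-1` [set x | x <= d ^+ 2]).
  apply: closed_comp; last exact: closed_le.
  by move=> X _; exact: continuous_frob_dotB.
by apply/seteqP; split => X /=; rewrite /frob_ball /= -sqr_frob ler_sqr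
  ?nnegrE ?frob_ge0.
Qed.

(** The ball is closed in a compact box, the continuous image under [vec_mx] of a product of
    segments. *)
Lemma compact_frob_ball m n (K : 'M[R]_(m, n)) d : compact (frob_ball K d).
Proof.
pose B := [set v : 'rV[R]_(m * n) | forall i,
  `[(mxvec K) 0 i - d, (mxvec K) 0 i + d]%classic (v ord0 i)].
have cB : compact B by apply: (rV_compact (A := fun i => `[_, _]%classic)) => i;
  exact: segment_compact.
apply: (@subclosed_compact _ _ (vec_mx @` B)); first exact: closed_frob_ball.
  apply: continuous_compact cB; apply: continuous_subspaceT => v.
  apply: cvg_continuous => F FF Fv.
  apply: mx_cvg => i j; rewrite mxE; under eq_fun do rewrite mxE.
  exact: mx_cvg_entry.
move=> X XK; exists (mxvec X); last by rewrite mxvecK.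
move=> k; case/mxvec_indexP: k => i j; rewrite /= in_itv /= !mxvecE.
have := le_trans (entry_le_frob (X - K) i j) XK; rewrite !mxE ler_norml.
by move=> /andP[? ?]; apply/andP; split; lra.
Qed.

Lemma frob_EVT_max m n (C : set 'M[R]_(m, n)) (f : 'M[R]_(m, n) -> R) :
  C !=set0 -> compact C -> (forall X, C X -> {for X, continuous f}) ->
  exists2 X, C X & forall Y, C Y -> f Y <= f X.
Proof.
move=> C0 cC cf; have [|X /set_mem CX fX] := compact_EVT_max C0 cC (f := f).
  by apply: continuous_in_subspaceT => X /set_mem; exact: cf.
by exists X => // Y CY; apply: fX; rewrite inE.
Qed.

End MatrixTopology.

(** * Decrease of the cost along one Goldstein step *)

Section GoldsteinDescent.
Variable R : realType.
Implicit Types m n : nat.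

(** Elementary form of letting t tend to 0 from the right, for first-order optimality conditions. *)
Lemma affine_ge0 (a b r : R) : 0 < r ->
  (forall t, 0 < t -> t < r -> 0 <= a + t * b) -> 0 <= a.
Proof.
move=> r0 abt; rewrite leNgt; apply/negP => a0.
pose u := r / 2 * `|b|; have u0 : 0 <= u by rewrite mulr_ge0 // ltW // divr_gt0.
have ua : 0 < u - a by lra.
(* For a < 0 this t lies in (0, r) and t |b| = - a u / (u - a) < - a, so a + t b < 0. *)
pose t := r / 2 * (- a / (u - a)).
have t0 : 0 < t by rewrite /t mulr_gt0 ?divr_gt0 ?oppr_gt0.
have q1 : - a / (u - a) <= 1 by rewrite ler_pdivrMr // mul1r; lra.
have tr : t < r by have := ler_wpM2l (ltW (divr_gt0 r0 (ltr0Sn _ 1))) q1;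
  rewrite -/t; lra.
have := abt t t0 tr; rewrite leNgt => /negP; apply.
have tb : t * b <= - a * (u / (u - a)).
  apply: (@le_trans _ _ (t * `|b|)); first by rewrite ler_pM2l // ler_norm.
  by rewrite le_eqVlt; apply/orP; left; apply/eqP; rewrite /t /u; ring.
have : u / (u - a) < 1 by rewrite ltr_pdivrMr // mul1r; lra.
move: (u / (u - a)) tb => w; nra.
Qed.

(** Testing with H = - t G and dividing by t leaves - |G|^2 + O(t) >= 0. *)
Lemma gradient_eq0 m n (G : 'M[R]_(m, n)) (C r : R) : 0 < r ->
  (forall H, frob H < r -> 0 <= frob_dot G H + C * frob_dot H H) -> G = 0.
Proof.
move=> r0 GH; apply/eqP; apply: contraT; rewrite -frob_gt0 => G0.
have GG0 : 0 < frob_dot G G by rewrite frob_dot_gt0 -frob_gt0.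
suff : 0 <= - frob_dot G G by rewrite oppr_ge0 leNgt GG0.
apply: (@affine_ge0 _ (C * frob_dot G G) (r / frob G)); first exact: divr_gt0.
move=> t t0 tr; rewrite -(pmulr_rge0 _ t0).
have /GH : frob (- t *: G) < r.
  by rewrite frobZ normrN (gtr0_norm t0) -ltr_pdivlMr.
by rewrite !frob_dotE; congr (_ <= _); ring.
Qed.

Lemma sub_conv_hull m n (S : set 'M[R]_(m, n)) : S `<=` conv_hull S.
Proof.
move=> G SG; exists 1%N, (fun=> 1), (fun=> G).
by rewrite !big_ord1 scale1r.
Qed.

Lemma convex_conv_hull m n (S : set 'M[R]_(m, n)) F G (t : R) :
  conv_hull S F -> conv_hull S G -> 0 <= t -> t <= 1 ->
  conv_hull S (F + t *: (G - F)).
Proof.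
move=> [p [w [X [w0 [w1 [SX ->]]]]]] [q [w' [Y [w'0 [w'1 [SY ->]]]]]] t0 t1.
exists (p + q)%N, (fun i => match fintype.split i with
  | inl j => (1 - t) * w j | inr j => t * w' j end),
  (fun i => match fintype.split i with inl j => X j | inr j => Y j end).
split; first by move=> i; case: fintype.split => j; rewrite mulr_ge0 // subr_ge0.
split; last split.
- rewrite big_split_ord /=.
  under eq_bigr do rewrite (unsplitK (inl _)).
  under [X in _ + X]eq_bigr do rewrite (unsplitK (inr _)).
  by rewrite -!mulr_sumr w1 w'1; ring.
- by move=> i; case: fintype.split.
- rewrite big_split_ord /=.
  under [X in _ = X + _]eq_bigr do rewrite (unsplitK (inl _)) -scalerA.
  under [X in _ = _ + X]eq_bigr do rewrite (unsplitK (inr _)) -scalerA.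
  rewrite -!scaler_sumr scalerBr scalerBl scale1r.
  by rewrite addrCA addrC.
Qed.

(** Variational inequality of the projection of 0 on a convex set: moving from F towards G cannot
    shorten F, so |F + t (G - F)|^2 has nonnegative slope at t = 0. *)
Lemma min_norm_elt_dot m n (S : set 'M[R]_(m, n)) F G :
  min_norm_elt (conv_hull S) F -> conv_hull S G ->
  frob_dot F F <= frob_dot G F.
Proof.
move=> [SF minF] SG; rewrite -subr_ge0.
suff : 0 <= 2 * (frob_dot G F - frob_dot F F) by lra.
apply: (@affine_ge0 _ (frob_dot (G - F) (G - F)) 1) => // t t0 t1.
have := minF _ (convex_conv_hull SF SG (ltW t0) (ltW t1)).
rewrite -ler_sqr ?nnegrE ?frob_ge0 // !sqr_frob -subr_ge0 => le0.
rewrite -(pmulr_rge0 _ t0); apply: le_trans le0 _.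
rewrite !frob_dotE (frob_dotC F G) le_eqVlt; apply/orP; left; apply/eqP; ring.
Qed.

(** Constant sequences exhibit a gradient as a limiting gradient at its own point. *)
Lemma has_gradient_goldstein m n (J : 'M[R]_(m, n) -> R) d K X G :
  frob (X - K) <= d -> has_gradient J X G -> goldstein_subdiff J d K G.
Proof.
move=> XK JG; apply: sub_conv_hull; exists X => //; apply: sub_conv_hull.
exists (fun=> X), (fun=> G); split=> //.
by split=> e e0; exists 0%N => k _; rewrite subrr frob0.
Qed.

(* The two properties of the cost that replace Rademacher's theorem: continuity,
   and differentiability wherever a quadratic touches the cost from above. *)
Definition touch_regular_at m n (J : 'M[R]_(m, n) -> R) (X : 'M[R]_(m, n)) :=
  {for X, continuous J} /\
  forall (G : 'M[R]_(m, n)) (C r : R), 0 < r ->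
    (forall H, frob H < r ->
       J (X + H) <= J X + frob_dot G H + C * frob_dot H H) ->
    has_gradient J X G.

(** Positive part, written with a norm so that its continuity is immediate. *)
Let pos (x : R) := (`|x| + x) / 2.

Let pos_ge0 x : 0 <= pos x.
Proof. by rewrite /pos; have := ler_norm (- x); rewrite normrN; lra. Qed.

Let pos_ge x : x <= pos x.
Proof. by rewrite /pos; have := ler_norm x; lra. Qed.

Let pos_le0 x : x <= 0 -> pos x = 0.
Proof. by move=> x0; rewrite /pos ler0_norm // addNr mul0r. Qed.

(** Smoothness of the penalty: the square of the positive part lies below its tangent at a plus
    b^2. *)
Let pos_sqrD a b : pos (a + b) ^+ 2 <= pos a ^+ 2 + 2 * pos a * b + b ^+ 2.
Proof.
rewrite /pos; have [a0|a0] := leP 0 a; have [b0|b0] := leP 0 (a + b);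
  rewrite ?(ger0_norm a0) ?(ltr0_norm a0) ?(ger0_norm b0) ?(ltr0_norm b0); nra.
Qed.

(* The maximum of J over the half ball, penalised so as to lie in the interior,
   is a point where J is touched from above with slope > - c along v. *)
Lemma descent_inside m n (J : 'M[R]_(m, n) -> R) (K v : 'M[R]_(m, n))
    (d c s : R) : 0 < s -> s < d -> frob v = 1 ->
  (forall X, frob (X - K) <= d -> touch_regular_at J X) ->
  (forall X G, frob (X - K) <= d -> has_gradient J X G -> frob_dot G v <= - c) ->
  J (K + s *: v) <= J K - c * s.
Proof.
move=> s0 sd v1 Jss Jgr; rewrite leNgt; apply/negP => gap.
have vv : frob_dot v v = 1 by rewrite -sqr_frob v1 expr1n.
have d0 : 0 < d by apply: lt_trans sd.
(* g > 0 is the amount by which the claimed decrease fails; c' < c gives up half of it, so that K +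
   s v still exceeds J K by g / 2 after the tilt. *)
pose g := J (K + s *: v) + c * s - J K; have g0 : 0 < g by rewrite /g; lra.
pose c' := c - g / (2 * s).
have c'c : c' < c by rewrite /c' ltrBlDr ltrDl divr_gt0 // mulr_gt0.
have c'g : J (K + s *: v) + c' * s = J K + g / 2.
  by rewrite /c' /g; field; rewrite gt_eqF.
have [e1 e10 Je1] : exists2 r : R, 0 < r & forall Y, frob (Y - K) < r ->
    J Y < J K + g / 2.
  have [JK _] : touch_regular_at J K by apply: Jss; rewrite subrr frob0 ltW.
  by apply: near_frob; apply: (cvgr_lt _ JK); rewrite ltrDl divr_gt0.
have [Z _ JZ] : exists2 Z, frob_ball K d Z &
    forall Y, frob_ball K d Y -> J Y <= J Z.
  apply: frob_EVT_max; [|exact: compact_frob_ball|by move=> X /Jss[]].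
  by exists K; rewrite /frob_ball /= subrr frob0 ltW.
pose e := Num.min e1 ((d - s) / 2).
have e0 : 0 < e by rewrite lt_min e10 divr_gt0 // subr_gt0.
(* D exceeds every gain of the tilted cost over J K in the half ball; with M = D / e^2 the penalty
   therefore keeps a maximiser within e of the segment from K to K + s v, up to that distance
   sideways and beyond the end. *)
pose D := `|J Z| + `|c'| * d + `|J K| + 1.
have D0 : 0 < D.
  by rewrite ltr_pwDr // !addr_ge0 // mulr_ge0 // ltW.
pose M := D / e ^+ 2.
have M0 : 0 < M by rewrite divr_gt0 // exprn_gt0.
(* Squared length of the component of X orthogonal to the unit vector v. *)
pose q (X : 'M[R]_(m, n)) := frob_dot X X - frob_dot X v ^+ 2.
have q_ge0 X : 0 <= q X.
  by rewrite subr_ge0 (le_trans (cauchy_schwarz _ _)) // vv mulr1.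
have qD X H : q (X + H) =
    q X + 2 * (frob_dot X H - frob_dot X v * frob_dot H v) + q H.
  by rewrite /q !frob_dotE (frob_dotC H X); ring.
(* J tilted by c' along v, minus a penalty for leaving the segment from K to K + s v sideways or
   beyond its end. *)
pose h (X : 'M[R]_(m, n)) := J X + c' * frob_dot (X - K) v
   - M * (pos (frob_dot (X - K) v - s) ^+ 2 + q (X - K)).
pose C := frob_ball K d `&` [set X | 0 <= frob_dot (X - K) v].
have cB (X : 'M[R]_(m, n)) (F : set_system 'M[R]_(m, n)) : Filter F ->
    t @[t --> F] --> X -> frob_dot (t - K) v @[t --> F] --> frob_dot (X - K) v.
  move=> FF FX; apply: frob_dot_cvg; last exact: cvg_cst.
  by apply: addmx_cvg => //; exact: cvg_cst.
have [X [XK Xv] hX] : exists2 X, C X & forall Y, C Y -> h Y <= h X.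
  apply: frob_EVT_max.
  - exists K; rewrite /C /frob_ball /= subrr frob0 frob_dot0l.
    by split=> //; exact: ltW.
  - apply: compact_closedI; first exact: compact_frob_ball.
    change (closed ((fun X : 'M[R]_(m, n) => frob_dot (X - K) v)
                      @^-1` [set x : R | 0 <= x])).
    apply: closed_comp; last exact: closed_ge.
    by move=> X _; apply: cvg_continuous => F FF FX; exact: cB.
  - move=> X [/Jss[JX _] _]; apply: cvg_continuous => F FF FX.
    have cBX := cB _ _ FF FX.
    have JX' : J t @[t --> F] --> J X by exact: (cvg_comp _ _ FX JX).
    apply: cvgB; first by apply: cvgD => //; apply: cvgM => //; exact: cvg_cst.
    apply: cvgM; first exact: cvg_cst.
    have cp : pos (frob_dot (t - K) v - s) @[t --> F] -->
        pos (frob_dot (X - K) v - s).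
      have cs : frob_dot (t - K) v - s @[t --> F] --> frob_dot (X - K) v - s.
        by apply: cvgB => //; exact: cvg_cst.
      by apply: cvgM; [apply: cvgD => //; exact: cvg_norm|exact: cvg_cst].
    apply: cvgD; first exact: cvgM.
    apply: cvgB; last exact: cvgM.
    have cX : (t - K) @[t --> F] --> (X - K).
      by apply: addmx_cvg => //; exact: cvg_cst.
    exact: frob_dot_cvg.
pose z := X - K; pose t := frob_dot z v; pose p := pos (t - s).
(* The penalty vanishes at K + s v, which lies in the half ball. *)
have hs : J K + g / 2 <= h X.
  have <- : h (K + s *: v) = J K + g / 2.
    rewrite /h /q [K + _]addrC addrK [_ *: v + K]addrC !frob_dotE vv !mulr1.
    by rewrite subrr pos_le0 // -expr2 subrr expr0n addr0 mulr0 subr0.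
  apply: hX; split; rewrite /frob_ball /= [K + _]addrC addrK.
    by rewrite frobZ v1 mulr1 gtr0_norm // ltW.
  by rewrite frob_dotZl vv mulr1 ltW.
have td : t <= d.
  apply: le_trans (ler_norm _) _; apply: le_trans (norm_frob_dot _ _) _.
  by rewrite v1 mulr1.
have JXZ : J X <= J Z by exact: JZ.
have hXE : h X = J X + c' * t - M * (p ^+ 2 + q z) by [].
have pq0 : 0 <= p ^+ 2 + q z by rewrite addr_ge0 // sqr_ge0.
have pqe : p ^+ 2 + q z < e ^+ 2.
  rewrite -(ltr_pM2l M0) {2}/M mulfVK ?gt_eqF ?exprn_gt0 //.
  have c't : c' * t <= `|c'| * d.
    apply: (@le_trans _ _ (`|c'| * t)); first by rewrite ler_wpM2r // ler_norm.
    by rewrite ler_wpM2l.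
  move: hs; rewrite hXE /D; have := ler_norm (J Z); have := ler_norm (- J K).
  rewrite normrN; lra.
have pe : p < e.
  rewrite -ltr_sqr ?nnegrE ?pos_ge0 ?(ltW e0) //.
  by apply: le_lt_trans pqe; rewrite lerDl.
have qe : q z < e ^+ 2.
  by apply: le_lt_trans pqe; rewrite lerDr sqr_ge0.
have zE : frob z ^+ 2 = t ^+ 2 + q z by rewrite sqr_frob /q addrC subrK.
(* At t = 0 the point X would lie within e1 of K, where J is below J K + g / 2. *)
have t0 : 0 < t.
  rewrite lt0r Xv andbT; apply/eqP => t0.
  have : frob z < e1.
    apply: (@lt_le_trans _ _ e); last by rewrite ge_min lexx.
    by rewrite -ltr_sqr ?nnegrE ?frob_ge0 ?(ltW e0) // zE t0 expr0n add0r.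
  move=> /Je1; rewrite ltNge => /negP; apply.
  rewrite (le_trans hs) // hXE t0 mulr0 addr0.
  by rewrite gerBl mulr_ge0 // ltW.
have ed : s + 2 * e <= d.
  have : e <= (d - s) / 2 by rewrite ge_min lexx orbT.
  lra.
have zd : frob z < d.
  rewrite -ltr_sqr ?nnegrE ?frob_ge0 ?(ltW d0) // zE.
  have := pos_ge (t - s); rewrite -/p => tp; nra.
(* Gradient at X of the penalty minus the tilt; by maximality of h, J is touched from above at X
   with slope G and curvature M. *)
pose G := (2 * M * p - c') *: v + (2 * M) *: (z - t *: v).
have : has_gradient J X G.
  have [_ /(_ G M (Num.min t (d - frob z)))] := Jss _ XK; apply.
    by rewrite lt_min t0 subr_gt0.
  move=> H; rewrite lt_min => /andP[Ht Hd].
  have := norm_frob_dot H v; rewrite v1 mulr1 ler_norml => /andP[Hv _].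
  have XHE : X + H - K = z + H by rewrite /z addrAC.
  have /hX : C (X + H).
    split; rewrite /frob_ball /= XHE.
      by apply: le_trans (frobD _ _) _; lra.
    by rewrite frob_dotDl -/t; lra.
  rewrite {1}/h XHE hXE.
  have -> : frob_dot (z + H) v = t + frob_dot H v by rewrite frob_dotDl.
  have -> : q (z + H) = q z + 2 * (frob_dot z H - t * frob_dot H v) +
      (frob_dot H H - frob_dot H v ^+ 2).
    by rewrite qD /q.
  have -> : frob_dot G H = (2 * M * p - c') * frob_dot H v +
      2 * M * (frob_dot z H - t * frob_dot H v).
    rewrite /G frob_dotDl 2!frob_dotZl frob_dotDl frob_dotNl.
    by rewrite frob_dotZl (frob_dotC v H).
  have := ler_wpM2l (ltW M0) (pos_sqrD (t - s) (frob_dot H v)).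
  rewrite (_ : t - s + frob_dot H v = t + frob_dot H v - s) -/p; last by ring.
  lra.
(* Here <G, v> = 2 M p - c' >= - c' > - c, against the bound on gradients. *)
move=> /(Jgr _ _ XK); rewrite /G frob_dotDl 2!frob_dotZl frob_dotDl frob_dotNl.
rewrite frob_dotZl vv !mulr1 -/t subrr mulr0 addr0.
have : 0 <= 2 * M * p by rewrite mulr_ge0 ?pos_ge0 // mulr_ge0 // ltW.
lra.
Qed.

(** K + d v is on the boundary of the ball; [descent_inside] for s < d passes to s = d by continuity
    of J there. *)
Lemma descent_step m n (J : 'M[R]_(m, n) -> R) (K v : 'M[R]_(m, n)) (d c : R) :
  0 < d -> frob v = 1 ->
  (forall X, frob (X - K) <= d -> touch_regular_at J X) ->
  (forall X G, frob (X - K) <= d -> has_gradient J X G -> frob_dot G v <= - c) ->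
  J (K + d *: v) <= J K - c * d.
Proof.
move=> d0 v1 Jss Jgr; rewrite leNgt; apply/negP => gap.
pose g := J (K + d *: v) - (J K - c * d).
have g0 : 0 < g by rewrite subr_gt0.
have [r r0 Jr] : exists2 r : R, 0 < r & forall Y, frob (Y - (K + d *: v)) < r ->
    J (K + d *: v) - g / 2 < J Y.
  have [JK _] : touch_regular_at J (K + d *: v).
    by apply: Jss; rewrite [K + _]addrC addrK frobZ v1 mulr1 gtr0_norm.
  by apply: near_frob; apply: (cvgr_gt _ JK); rewrite gtrBl divr_gt0.
(* Small enough for continuity at the endpoint (r), a positive step (d) and a change of c s by at
   most g / 2. *)
pose eta := Num.min (r / 2) (Num.min (d / 2) (g / (2 * (`|c| + 1)))).
have c1 : 0 < `|c| + 1 by rewrite ltr_wpDl.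
have eta0 : 0 < eta by rewrite !lt_min !divr_gt0 // mulr_gt0.
have etar : eta <= r / 2 by rewrite ge_min lexx.
have etad : eta <= d / 2 by rewrite !ge_min lexx orbT.
have etag : eta * (2 * (`|c| + 1)) <= g.
  by rewrite -ler_pdivlMr ?mulr_gt0 // !ge_min lexx !orbT.
have := Jr (K + (d - eta) *: v); rewrite opprD addrACA subrr add0r -scalerBl.
rewrite frobZ v1 mulr1 (_ : d - eta - d = - eta); last by ring.
rewrite normrN (gtr0_norm eta0) => Jeta.
have /Jeta : eta < r by lra.
have : J (K + (d - eta) *: v) <= J K - c * (d - eta).
  by apply: (@descent_inside _ _ _ _ _ d) => //; lra.
have : c * eta <= `|c| * eta by rewrite ler_pM2r // ler_norm.
rewrite /g in etag *; lra.
Qed.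

Lemma goldstein_descent m n (J : 'M[R]_(m, n) -> R) (K F : 'M[R]_(m, n)) d :
  0 < d -> (forall X, frob (X - K) <= d -> touch_regular_at J X) ->
  min_norm_elt (goldstein_subdiff J d K) F ->
  J (K - (d / frob F) *: F) <= J K - frob F * d.
Proof.
(* If F = 0 the step is null, and so is the decrease to be shown. *)
move=> d0 Jss minF; have [->|F0] := eqVneq F 0.
  by rewrite scaler0 subr0 frob0 mul0r subr0.
have fF : 0 < frob F by rewrite frob_gt0.
have -> : K - (d / frob F) *: F = K + d *: (- (frob F)^-1 *: F).
  by rewrite scalerA mulrN scaleNr.
apply: descent_step => //.
  by rewrite frobZ normrN gtr0_norm ?invr_gt0 // mulVf ?gt_eqF.
(* [min_norm_elt_dot] gives <G, F> >= |F|^2, that is a slope of at most - |F| along - F / |F|. *)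
move=> X G XK JG; rewrite frob_dotZr mulNr lerN2 mulrC ler_pdivlMr // -expr2.
rewrite sqr_frob; apply: min_norm_elt_dot minF _.
exact: has_gradient_goldstein JG.
Qed.

End GoldsteinDescent.

(** * Quadratic expansions and differentiability of a function touched from above *)

Section QuadraticModels.
Variable R : realType.
Variables m n : nat.
Implicit Types (f g J : 'M[R]_(m, n) -> R) (X G H : 'M[R]_(m, n)).

(** A Taylor bound with quadratic error, on the unit ball so that the higher-order terms of a
    product are absorbed. *)
Definition quad_model f X G := exists2 C : R, 0 <= C &
  forall H, frob H <= 1 ->
    `|f (X + H) - f X - frob_dot G H| <= C * frob_dot H H.

Lemma quad_modelB f g X Gf Gg : quad_model f X Gf -> quad_model g X Gg ->
  quad_model (fun Y => f Y - g Y) X (Gf - Gg).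
Proof.
move=> [Cf Cf0 fX] [Cg Cg0 gX]; exists (Cf + Cg); first exact: addr_ge0.
move=> H H1; have := fX H H1; have := gX H H1; rewrite mulrDl !frob_dotE.
rewrite !ler_norml => /andP[? ?] /andP[? ?]; apply/andP; split; lra.
Qed.

Lemma quad_modelM f g X Gf Gg : quad_model f X Gf -> quad_model g X Gg ->
  quad_model (fun Y => f Y * g Y) X (f X *: Gg + g X *: Gf).
Proof.
move=> [Cf Cf0 fX] [Cg Cg0 gX].
exists (`|f X| * Cg + `|g X| * Cf + (frob Gf + Cf) * (frob Gg + Cg)).
  by rewrite !addr_ge0 ?mulr_ge0 ?addr_ge0 ?frob_ge0.
move=> H H1; have := fX H H1; have := gX H H1.
have := norm_frob_dot Gf H; have := norm_frob_dot Gg H; rewrite !frob_dotE.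
move: (frob_dot Gf H) (frob_dot Gg H) => a b; rewrite -!sqr_frob.
set s := g _ - _ - _; set r := f _ - _ - _.
have -> : g (X + H) = g X + (b + s) by rewrite /s; ring.
have -> : f (X + H) = f X + (a + r) by rewrite /r; ring.
have h0 := frob_ge0 H; move: (frob H) h0 H1 => h h0 h1 bh ah sh rh.
have h2 : h ^+ 2 <= h by rewrite expr2 -[leRHS]mulr1 ler_wpM2l.
(* Since |H|^2 <= |H|, both full increments a + r and b + s are O(|H|). *)
rewrite (_ : _ - _ - _ = f X * s + g X * r + (a + r) * (b + s)); last by ring.
apply: le_trans (ler_normD _ _) _; rewrite [leRHS]mulrDl lerD //.
  apply: le_trans (ler_normD _ _) _; rewrite [leRHS]mulrDl lerD // normrM -mulrA;
  by rewrite ler_wpM2l.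
rewrite normrM expr2 mulrACA ler_pM //; apply: le_trans (ler_normD _ _) _;
  rewrite [leRHS]mulrDl lerD //.
  by apply: le_trans rh _; rewrite ler_wpM2l.
by apply: le_trans sh _; rewrite ler_wpM2l.
Qed.

Lemma quad_model_continuous f X G : quad_model f X G ->
  forall e : R, 0 < e -> exists2 r : R, 0 < r &
  forall H, frob H < r -> `|f (X + H) - f X| < e.
Proof.
move=> [C C0 fX] e e0; pose L := frob G + C + 1.
have L0 : 0 < L by rewrite ltr_wpDl ?addr_ge0 ?frob_ge0.
exists (Num.min 1 (e / L)); first by rewrite lt_min ltr01 divr_gt0.
move=> H; rewrite lt_min ltr_pdivlMr // => /andP[/ltW H1 HL].
apply: le_lt_trans HL; have := fX H H1; have := norm_frob_dot G H.
rewrite -sqr_frob; have := frob_ge0 H; rewrite /L.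
move: (frob H) H1 (frob G) => h h1 k h0 + Ch.
have h2 : C * h ^+ 2 <= C * h by rewrite ler_wpM2l // expr2 -[leRHS]mulr1 ler_wpM2l.
move: Ch; rewrite !ler_norml => /andP[? ?] /andP[? ?].
by apply/andP; split; lra.
Qed.

Lemma quad_model_touch X G (a C : R) :
  quad_model (fun Y => a + frob_dot G (Y - X) + C * frob_dot (Y - X) (Y - X)) X G.
Proof.
exists `|C| => // H _; rewrite subrr !frob_dot0r mulr0 !addr0.
rewrite [X + H]addrC addrK (_ : _ - _ - _ = C * frob_dot H H); last by ring.
by rewrite normrM ler_wpM2l // ger0_norm // frob_dot_ge0.
Qed.

(** With U the quadratic above J, P = U^2 D - N is nonnegative near X and zero at X, so its gradient
    vanishes and P = O(|H|^2). As (U - J) U D <= P and U D stays away from 0, U - J = O(|H|^2) and J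
    inherits the gradient of U. *)
Lemma touched_above_gradient J N D X GN GD G (C r s : R) :
  quad_model N X GN -> quad_model D X GD ->
  0 < J X -> 0 < D X -> N X = J X ^+ 2 * D X ->
  0 < r -> (forall H, frob H < r ->
    0 <= J (X + H) /\ N (X + H) <= J (X + H) ^+ 2 * D (X + H)) ->
  0 < s -> (forall H, frob H < s ->
    J (X + H) <= J X + frob_dot G H + C * frob_dot H H) ->
  has_gradient J X G.
Proof.
move=> mN mD J0 D0 NX r0 NJ s0 JU.
pose U Y := J X + frob_dot G (Y - X) + C * frob_dot (Y - X) (Y - X).
have mU : quad_model U X G by exact: quad_model_touch.
have UE H : U (X + H) = J X + frob_dot G H + C * frob_dot H H.
  by rewrite /U [X + H]addrC addrK.
have UX : U X = J X by rewrite -[X in U X]addr0 UE !frob_dotE mulr0 !addr0.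
have mUD := quad_modelM mU mD.
have := quad_modelB (quad_modelM mU mUD) mN; set GP := (X in quad_model _ _ X) => mP.
pose P Y := U Y * (U Y * D Y) - N Y.
have PX : P X = 0 by rewrite /P UX NX; ring.
have [C1 C10 hP] := mP.
have [d1 d10 hD] := quad_model_continuous mD D0.
have Dpos H : frob H < d1 -> 0 < D (X + H).
  by move=> /hD; rewrite ltr_norml => /andP[]; lra.
(* Half the value of U D at X, hence a lower bound for U D nearby. *)
pose M := J X * D X / 2.
have M0 : 0 < M by rewrite divr_gt0 // mulr_gt0.
have [d2 d20 hUD] := quad_model_continuous mUD M0.
have UDM H : frob H < d2 -> M < U (X + H) * D (X + H).
  by move=> /hUD; rewrite UX ltr_norml => /andP[+ _]; rewrite /M; lra.
pose d := Num.min (Num.min r s) (Num.min (Num.min d1 d2) 1).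
have d0 : 0 < d by rewrite !lt_min r0 s0 d10 d20 ltr01.
have below H : frob H < d -> 0 <= P (X + H) /\
    (U (X + H) - J (X + H)) * (U (X + H) * D (X + H)) <= P (X + H).
  rewrite !lt_min => /andP[/andP[/NJ[JH NH] /JU]].
  rewrite -UE => JUH /andP[/andP[/Dpos DH _] _].
  have JJ : J (X + H) ^+ 2 * D (X + H) <= J (X + H) * U (X + H) * D (X + H).
    by rewrite ler_pM2r // expr2 ler_wpM2l.
  have UU : J (X + H) * U (X + H) * D (X + H) <= U (X + H) * U (X + H) * D (X + H).
    by rewrite ler_pM2r // ler_wpM2r // (le_trans JH).
  by rewrite /P; split; lra.
have GP0 : GP = 0.
  apply: (gradient_eq0 (C := C1) d0) => H Hd; have [PH _] := below H Hd; move: Hd.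
  rewrite !lt_min => /andP[_ /andP[_ /ltW /hP]].
  by rewrite -/(P _) -/(P _) PX ler_norml => /andP[_]; lra.
have PC H : frob H < d -> P (X + H) <= C1 * frob_dot H H.
  rewrite !lt_min => /andP[_ /andP[_ /ltW /hP]].
  by rewrite -/(P _) -/(P _) PX GP0 frob_dot0l !subr0 ler_norml => /andP[].
(* C1 / M bounds U - J and |C| the quadratic term of U, so |H| < e / L keeps the error below e
   |H|. *)
move=> e e0; pose L := C1 / M + `|C| + 1.
have CM0 : 0 <= C1 / M by rewrite divr_ge0 // ltW.
have L0 : 0 < L by rewrite ltr_wpDl // addr_ge0.
exists (Num.min d (e / L)); split; first by rewrite lt_min d0 divr_gt0.
move=> H; rewrite lt_min ltr_pdivlMr // => /andP[Hd He].
have [_ le1] := below H Hd; have le2 := PC H Hd.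
have /UDM MH : frob H < d2.
  by move: Hd; rewrite !lt_min => /andP[_ /andP[/andP[]]].
have /JU : frob H < s by move: Hd; rewrite !lt_min => /andP[/andP[]].
rewrite -UE => JUH.
have UJ : U (X + H) - J (X + H) <= C1 / M * frob_dot H H.
  rewrite mulrAC ler_pdivlMr //; apply: le_trans le2; apply: le_trans le1.
  by rewrite ler_wpM2l ?subr_ge0 // ltW.
have hh : (C1 / M + `|C|) * frob_dot H H <= e * frob H.
  rewrite -sqr_frob expr2 mulrA ler_wpM2r ?frob_ge0 //.
  apply: le_trans (ltW He); rewrite mulrC ler_wpM2l ?frob_ge0 // /L; lra.
have := ler_wpM2r (frob_dot_ge0 H) (ler_norm C).
have := ler_wpM2r (frob_dot_ge0 H) (ler_norm (- C)); rewrite normrN.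
have := mulr_ge0 CM0 (frob_dot_ge0 H).
move: UJ JUH hh; rewrite UE mulrDl ler_norml => *; apply/andP; split; lra.
Qed.

End QuadraticModels.

(** * Complex vectors as real two-column matrices *)

Section ComplexBridge.
Variable R : realType.
Implicit Types m n p : nat.

Local Notation C := R[i].

Lemma cmxE m n (M : 'M[R]_(m, n)) : cmx M = map_mx (real_complex R) M.
Proof. by []. Qed.

Lemma cmxM m n p (X : 'M[R]_(m, n)) (Y : 'M[R]_(n, p)) :
  cmx (X *m Y) = cmx X *m cmx Y.
Proof. by rewrite !cmxE map_mxM. Qed.

Lemma cmxD m n (X Y : 'M[R]_(m, n)) : cmx (X + Y) = cmx X + cmx Y.
Proof. by rewrite !cmxE map_mxD. Qed.

Lemma cmxB m n (X Y : 'M[R]_(m, n)) : cmx (X - Y) = cmx X - cmx Y.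
Proof. by rewrite !cmxE map_mxB. Qed.

Lemma cmxZ m n a (X : 'M[R]_(m, n)) : cmx (a *: X) = (a%:C)%C *: cmx X.
Proof. by rewrite !cmxE map_mxZ. Qed.

Definition star m n (X : 'M[C]_(m, n)) : 'M[C]_(n, m) := (map_mx conjc X)^T.

Lemma starK m n (X : 'M[C]_(m, n)) : star (star X) = X.
Proof. by apply/matrixP => i j; rewrite !mxE conjcK. Qed.

Lemma starM m n p (X : 'M[C]_(m, n)) (Y : 'M[C]_(n, p)) :
  star (X *m Y) = star Y *m star X.
Proof. by rewrite /star map_mxM trmx_mul. Qed.

Lemma star_cmx m n (X : 'M[R]_(m, n)) : star (cmx X) = cmx X^T.
Proof. by apply/matrixP => i j; rewrite /star /cmx !mxE; exact: conjc_real. Qed.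

Lemma starZ_real m n (a : R) (X : 'M[C]_(m, n)) :
  star ((a%:C)%C *: X) = (a%:C)%C *: star X.
Proof. by apply/matrixP => i j; rewrite !mxE rmorphM /= oppr0. Qed.

Lemma star_eq0 m n (X : 'M[C]_(m, n)) : (star X == 0) = (X == 0).
Proof.
apply/eqP/eqP => [X0|->]; last by rewrite /star map_mx0 trmx0.
by rewrite -[X]starK X0 /star map_mx0 trmx0.
Qed.

(* A complex vector is encoded by the real two-column matrix of its real and
   imaginary parts; multiplication by 'i is then right multiplication by mx_i. *)
Definition mx_1i : 'cV[C]_2 := \col_i (if i == 0 then 1 else 'i%C).

Definition mx_i : 'M[R]_2 :=
  \matrix_(i, j) (if i == j then 0 else if i == 0 then 1 else -1).

Definition toC n (W : 'M[R]_(n, 2)) : 'cV[C]_n := cmx W *m mx_1i.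

Lemma toCE n (W : 'M[R]_(n, 2)) i :
  toC W i 0 = (W i ord0 +i* W i ord_max)%C.
Proof.
rewrite mxE !big_ord_recl big_ord0 !mxE /= mulr1 addr0.
rewrite (_ : lift ord0 ord0 = ord_max); last exact/val_inj.
by apply/eqP; rewrite eq_complex /=; apply/andP; split; apply/eqP; ring.
Qed.

Lemma toC_eq0 n (W : 'M[R]_(n, 2)) : (toC W == 0) = (W == 0).
Proof.
apply/eqP/eqP => [W0|->]; last by rewrite /toC cmxE map_mx0 mul0mx.
apply/matrixP => i j; move/matrixP/(_ i 0): W0; rewrite toCE !mxE => -[Wi0 Wi1].
case: j => [[|[|//]] hj].
  by rewrite -[RHS]Wi0; congr (W i _); exact/val_inj.
by rewrite -[RHS]Wi1; congr (W i _); exact/val_inj.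
Qed.

Lemma toC_surj n (u : 'cV[C]_n) : exists W, toC W = u.
Proof.
exists (\matrix_(i, j) (if j == 0 then complex.Re (u i 0) else complex.Im (u i 0))).
apply/matrixP => i j; rewrite (ord1 j) toCE !mxE /=.
by case: (u i 0).
Qed.

Lemma toC_mulmx m n (M : 'M[R]_(m, n)) W : toC (M *m W) = cmx M *m toC W.
Proof. by rewrite /toC cmxM mulmxA. Qed.

Lemma toCD n (V W : 'M[R]_(n, 2)) : toC (V + W) = toC V + toC W.
Proof. by rewrite /toC cmxD mulmxDl. Qed.

Lemma toCB n (V W : 'M[R]_(n, 2)) : toC (V - W) = toC V - toC W.
Proof. by rewrite /toC cmxB mulmxBl. Qed.

Lemma toCZ n a (W : 'M[R]_(n, 2)) : toC (a *: W) = (a%:C)%C *: toC W.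
Proof. by rewrite /toC cmxZ scalemxAl. Qed.

Lemma toC_mx_i n (W : 'M[R]_(n, 2)) : toC (W *m mx_i) = 'i%C *: toC W.
Proof.
apply/matrixP => i j; rewrite (ord1 j) [RHS]mxE !toCE !mxE.
rewrite !big_ord_recl !big_ord0 !mxE /=.
rewrite (_ : lift ord0 ord0 = ord_max); last exact/val_inj.
by apply/eqP; rewrite eq_complex /=; apply/andP; split; apply/eqP; ring.
Qed.

Lemma toC_tr_mx_i n (W : 'M[R]_(n, 2)) : toC (W *m mx_i^T) = - 'i%C *: toC W.
Proof.
have -> : mx_i^T = - mx_i.
  apply/matrixP => i j; rewrite !mxE eq_sym; case: ifPn => //; rewrite ?oppr0 //.
  by case: i => [[|[|//]] ?]; case: j => [[|[|//]] ?]; rewrite //= opprK.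
by rewrite mulmxN -scaleN1r toCZ toC_mx_i scalerA; congr (_ *: _);
   rewrite rmorphN1 mulN1r.
Qed.

Lemma Re_sum (I : finType) (F : I -> C) :
  complex.Re (\sum_i F i) = \sum_i complex.Re (F i).
Proof.
apply: (big_ind2 (fun (x : C) y => complex.Re x = y)) => // x _ y _ <- <-.
by case: x y => ? ? [].
Qed.

Lemma Im_sum (I : finType) (F : I -> C) :
  complex.Im (\sum_i F i) = \sum_i complex.Im (F i).
Proof.
apply: (big_ind2 (fun (x : C) y => complex.Im x = y)) => // x _ y _ <- <-.
by case: x y => ? ? [].
Qed.

(** Makes the encoding isometric, so Hermitian forms can be computed with Frobenius products. *)
Lemma Re_star_toC n (V W : 'M[R]_(n, 2)) :
  complex.Re ((star (toC V) *m toC W) 0 0) = frob_dot V W.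
Proof.
rewrite mxE Re_sum; apply: eq_bigr => i _; rewrite mxE [map_mx _ _ _ _]mxE !toCE /=.
rewrite !big_ord_recl big_ord0 (_ : lift ord0 ord0 = ord_max); last exact/val_inj.
by ring.
Qed.

Lemma Im_star_toC n (V : 'M[R]_(n, 2)) :
  complex.Im ((star (toC V) *m toC V) 0 0) = 0.
Proof.
rewrite mxE Im_sum big1 // => i _; rewrite mxE [map_mx _ _ _ _]mxE !toCE /=.
by ring.
Qed.

(** Needed for [sup] to bound the spectrum: the characteristic polynomial splits, and a root has
    modulus at most the sum of the moduli of all roots. *)
Lemma eigenvalues_bounded n (M : 'M[C]_n) :
  has_ubound [set Normc.normc z | z in [set z : C | eigenvalue M z]].
Proof.
have [rs rsE] := closed_field_poly_normal (char_poly M).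
exists (\sum_(r <- rs) Normc.normc r) => _ [z /= zM <-].
move: zM; rewrite eigenvalue_root_char rsE (monicP (char_poly_monic M)) scale1r.
rewrite root_prod_XsubC => zrs; rewrite (big_rem z) //= lerDl.
by apply: sumr_ge0 => -[a b] _; exact: sqrtr_ge0.
Qed.

End ComplexBridge.

(** * The cost as a family of quotients *)

Section HinfCost.
Variable R : realType.
Variables (nx nu : nat) (A : 'M[R]_nx) (B : 'M[R]_(nx, nu)).
Variables (Q : 'M[R]_nx) (Rm : 'M[R]_nu).
Hypotheses (hQ : sym_posdef Q) (hR : sym_posdef Rm).
Implicit Types (K H : 'M[R]_(nu, nx)) (W Y : 'M[R]_(nx, 2)) (w mu : R).

Local Notation C := R[i].
Local Notation J := (Hinf_cost A B Q Rm).

(** The pencil e^(iw) I - (A - BK), inverted in [response]; its terms keep the order they have in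
    [Hinf_cost]. *)
Definition resolvent w K : 'M[C]_nx := (expj w)%:M - cmx A + cmx B *m cmx K.

Definition weight K : 'M[R]_nx := Q + K^T *m Rm *m K.

Definition response w K : 'M[C]_nx :=
  (invmx (resolvent (- w) K))^T *m cmx (weight K) *m invmx (resolvent w K).

(* The real form of x |-> (e^(iw) - A + BK) x. *)
Definition resolv w K W : 'M[R]_(nx, 2) :=
  cos w *: W + sin w *: (W *m mx_i R) - (A - B *m K) *m W.

(** Adjoint of [resolv w K] for the Frobenius inner product. *)
Definition resolv_adj w K W : 'M[R]_(nx, 2) :=
  cos w *: W + sin w *: (W *m (mx_i R)^T) - (A - B *m K)^T *m W.

(** Numerator of the quotient in the real encoding. K comes last in [costN] and [costD] so that both
    are read as functions of K. *)
Definition costN W K : R :=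
  frob_dot W (Q *m W) + frob_dot (K *m W) (Rm *m (K *m W)).

Definition costD w W K : R := frob_dot (resolv w K W) (resolv w K W).

(** No eigenvalue of A - BK lies on the unit circle; the form in which stability enters the analysis
    of J. *)
Definition regular K := forall w W, 0 <= w <= 2 * pi -> W != 0 ->
  resolv w K W != 0.

Lemma costN_weight W K : costN W K = frob_dot W (weight K *m W).
Proof.
by rewrite /costN /weight mulmxDl frob_dotDr -!mulmxA -(frob_dot_mulmxl K W).
Qed.

Lemma weight_sym K : (weight K)^T = weight K.
Proof.
have [Qs _] := hQ; have [Rs _] := hR.
by rewrite /weight linearD /= !trmx_mul trmxK Qs Rs mulmxA.
Qed.

Lemma resolventE w K : resolvent w K = (expj w)%:M - cmx (A - B *m K).
Proof. by rewrite /resolvent cmxB cmxM opprB -addrA [- _ + _]addrC. Qed.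

Lemma toC_resolv w K W : toC (resolv w K W) = resolvent w K *m toC W.
Proof.
rewrite resolventE /resolv toCB toCD !toCZ toC_mx_i toC_mulmx.
rewrite scalerA -scalerDl mulmxBl mul_scalar_mx; congr (_ *: _ - _).
by apply/eqP; rewrite eq_complex /=; apply/andP; split; apply/eqP; ring.
Qed.

Lemma conj_resolvent w K : map_mx conjc (resolvent w K) = resolvent (- w) K.
Proof.
rewrite !resolventE map_mxB map_scalar_mx /= (_ : map_mx _ (cmx _) = cmx (A - B *m K)).
  by rewrite /expj /= cosN sinN.
by apply/matrixP => i j; rewrite /cmx !mxE; exact: conjc_real.
Qed.

(** A, B, K are real, so the pencil at - w is the conjugate of that at w and the plain transpose
    acts as a conjugate transpose. *)
Lemma responseE w K : response w K =
  star (invmx (resolvent w K)) *m cmx (weight K) *m invmx (resolvent w K).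
Proof. by rewrite /response -conj_resolvent /star map_invmx. Qed.

Lemma toC_resolv_adj w K W :
  toC (resolv_adj w K W) = star (resolvent w K) *m toC W.
Proof.
rewrite /star conj_resolvent /resolv_adj toCB toCD !toCZ toC_tr_mx_i toC_mulmx.
rewrite scalerA -scalerDl resolventE [in RHS]linearB /= tr_scalar_mx.
rewrite [in RHS]mulmxBl mul_scalar_mx.
rewrite (_ : (cmx (A - B *m K))^T = cmx (A - B *m K)^T); last first.
  by apply/matrixP => i j; rewrite /cmx !mxE.
congr (_ *: _ - _).
by apply/eqP; rewrite eq_complex /= cosN sinN; apply/andP; split; apply/eqP; ring.
Qed.

Lemma frob_dot_resolv w K W Y :
  frob_dot (resolv w K W) Y = frob_dot W (resolv_adj w K Y).
Proof.
rewrite /resolv /resolv_adj !frob_dotE frob_dot_mulmxr frob_dot_mulmxl.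
by [].
Qed.

Lemma regular_unitmx w K : regular K -> 0 <= w <= 2 * pi ->
  resolvent w K \in unitmx.
Proof.
move=> regK hw; rewrite -unitmx_tr unitmxE unitfE; apply/det0P => -[v v0 vL].
have [W WE] := toC_surj v^T.
have W0 : W != 0 by rewrite -toC_eq0 WE trmx_eq0.
have := regK w W hw W0; rewrite -toC_eq0 toC_resolv WE => /eqP; apply.
by rewrite -[resolvent w K]trmxK -trmx_mul vL trmx0.
Qed.

(** A kernel vector would make e^(iw), of modulus 1, an eigenvalue of A - BK. *)
Lemma stab_regular K : stab_set A B K -> regular K.
Proof.
rewrite /stab_set /= => rho w W _ W0; apply/negP.
rewrite -toC_eq0 toC_resolv => /eqP L0.
have nunit : cmx (A - B *m K) - (expj w)%:M \notin unitmx.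
  apply/negP => Lu; move: W0; rewrite -toC_eq0 => /eqP; apply.
  rewrite -(mulKmx Lu (toC W)) (_ : _ *m toC W = 0) ?mulmx0 //.
  by rewrite -[LHS]opprK -mulNmx opprB -resolventE L0 oppr0.
have : eigenvalue (cmx (A - B *m K)) (expj w).
  by rewrite /eigenvalue /eigenspace kermx_eq0 row_free_unit.
move=> ev; move: rho; apply/negP; rewrite -leNgt.
apply: ub_le_sup; first exact: eigenvalues_bounded.
exists (expj w) => //; rewrite /expj /=.
by rewrite cos2Dsin2 sqrtr1.
Qed.

Lemma costD_ge0 w W K : 0 <= costD w W K.
Proof. exact: frob_dot_ge0. Qed.

Lemma regular_costD_gt0 w W K : regular K -> 0 <= w <= 2 * pi -> W != 0 ->
  0 < costD w W K.
Proof. by move=> regK hw W0; rewrite frob_dot_gt0 regK. Qed.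

Lemma posdef_dot n p (M : 'M[R]_n) (X : 'M[R]_(n, p)) : sym_posdef M ->
  0 <= frob_dot X (M *m X) ?= iff (X == 0).
Proof.
move=> [_ Mpos].
have XE : frob_dot X (M *m X) =
    \sum_(j < p) ((col j X)^T *m M *m (col j X)^T^T) 0 0.
  rewrite frob_dot_tr /mxtrace; apply: eq_bigr => j _.
  by rewrite trmxK -mulmxA !mxE; apply: eq_bigr => i _; rewrite !mxE;
    congr (_ * _); apply: eq_bigr => k _; rewrite !mxE.
have pos j : 0 <= ((col j X)^T *m M *m (col j X)^T^T) 0 0.
  have [->|cj] := eqVneq (col j X)^T 0; first by rewrite !mul0mx mxE.
  exact/ltW/Mpos.
split; rewrite XE; first by apply: sumr_ge0.
apply/idP/eqP => [|->]; last first.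
  by rewrite big1 // => j _; rewrite (_ : col j 0 = 0) ?trmx0 ?mulmx0 ?mxE //;
    apply/matrixP => ? ?; rewrite !mxE.
rewrite eq_sym psumr_eq0 // => /allP X0; apply/matrixP => i j.
apply/eqP; rewrite mxE; apply: contraT => Xij.
have := X0 j (mem_index_enum _) => /eqP /= Xj.
have /Mpos : (col j X)^T != 0.
  by apply: contraNneq Xij => /matrixP/(_ 0 i); rewrite !mxE => ->.
by rewrite Xj ltxx.
Qed.

Lemma costN_gt0 W K : W != 0 -> 0 < costN W K.
Proof.
move=> W0; apply: ltr_wpDr; first by have [] := posdef_dot (K *m W) hR.
have [Wge Weq] := posdef_dot W hQ.
by rewrite lt_neqAle Wge andbT Weq.
Qed.

(** * Eigenvalues of the response matrix as quotients *)

Lemma eigenvalue_quotient w K (z : C) : regular K -> 0 <= w <= 2 * pi ->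
  eigenvalue (response w K) z ->
  exists2 W, W != 0 & costN W K = complex.Re z * costD w W K.
Proof.
move=> regK hw /eigenvalueP[v vM v0].
have Lu := regular_unitmx regK hw; set X := invmx (resolvent w K).
(* W encodes the preimage under the pencil of the conjugate transpose of the left eigenvector v; the
   Hermitian form of the response at v is then computed in two ways. *)
have [W WE] := toC_surj (X *m star v).
have LW : toC (resolv w K W) = star v by rewrite toC_resolv WE mulKVmx.
exists W; first by rewrite -toC_eq0 WE; apply: contraNneq v0 => X0;
  rewrite -star_eq0 -[star v](mulKVmx Lu) X0 mulmx0.
have : (v *m response w K *m star v) 0 0 = (z *: v *m star v) 0 0 by rewrite vM.
rewrite responseE -/X => /(congr1 (@complex.Re R)).
have -> : v *m (star X *m cmx (weight K) *m X) *m star v =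
    star (toC W) *m toC (weight K *m W).
  by rewrite toC_mulmx WE starM starK !mulmxA.
rewrite Re_star_toC -costN_weight => ->.
rewrite -scalemxAl mxE -LW -{1}[v]starK -LW.
move: (Re_star_toC (resolv w K W) (resolv w K W)) (Im_star_toC (resolv w K W)).
rewrite /costD; case: (_ 0 0) => a b /= <- ->; case: z {vM} => c d /=.
by rewrite mulr0 subr0.
Qed.

Lemma resolvD w K W Y : resolv w K (W + Y) = resolv w K W + resolv w K Y.
Proof.
rewrite /resolv mulmxDl mulmxDr !scalerDr opprD.
rewrite [cos w *: W + cos w *: Y + _]addrACA.
exact: addrACA.
Qed.

Lemma resolvZ w K W a : resolv w K (a *: W) = a *: resolv w K W.
Proof.
rewrite /resolv -scalemxAl -scalemxAr !scalerBr !scalerDr.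
by rewrite !scalerA ![a * _]mulrC.
Qed.

Lemma costNZ W K a : costN (a *: W) K = a ^+ 2 * costN W K.
Proof. by rewrite !costN_weight -scalemxAr !frob_dotE; ring. Qed.

Lemma costDZ w W K a : costD w (a *: W) K = a ^+ 2 * costD w W K.
Proof. by rewrite /costD resolvZ !frob_dotE; ring. Qed.

(** mu D - N is a nonnegative quadratic form vanishing at W, so W lies in its kernel. *)
Lemma maximizer_critical w K W mu :
  (forall Y, costN Y K <= mu * costD w Y K) ->
  costN W K = mu * costD w W K ->
  weight K *m W = mu *: resolv_adj w K (resolv w K W).
Proof.
move=> Ymu Wmu; apply/eqP; rewrite -subr_eq0.
set T := _ - _; rewrite -[T == 0]negbK -frob_dot_gt0 -leNgt.
have TT : frob_dot T T = frob_dot T (weight K *m W) -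
    mu * frob_dot T (resolv_adj w K (resolv w K W)).
  by rewrite {2}/T frob_dotDr frob_dotNr frob_dotZr.
(* With T the residual, - 2 |T|^2 is the coefficient of t in the form at W + t T. *)
clearbody T; suff : 0 <= - (2 * frob_dot T T) by lra.
apply: (@affine_ge0 _ _ (mu * costD w T K - costN T K) 1) => // t t0 _.
rewrite -(pmulr_rge0 _ t0); have := Ymu (W + t *: T); rewrite -subr_ge0.
have WT : frob_dot W (weight K *m T) = frob_dot T (weight K *m W).
  by rewrite -{1}(weight_sym K) -frob_dot_mulmxl frob_dotC.
have TL := frob_dot_resolv w K T (resolv w K W).
move: Wmu; rewrite !costN_weight /costD resolvD resolvZ mulmxDr -scalemxAr.
rewrite {}TT -{}TL; move: (resolv w K W) (resolv w K T) => L1 L2.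
rewrite !(frob_dotDr, frob_dotDl, frob_dotZr, frob_dotZl) WT (frob_dotC L1 L2) => ->.
by congr (_ <= _); ring.
Qed.

(** The left eigenvector is the conjugate transpose of the pencil applied to W; the critical point
    equation becomes its eigenvalue equation. *)
Lemma maximizer_eigenvalue w K W mu : regular K -> 0 <= w <= 2 * pi -> W != 0 ->
  (forall Y, costN Y K <= mu * costD w Y K) ->
  costN W K = mu * costD w W K ->
  eigenvalue (response w K) (mu%:C)%C.
Proof.
move=> regK hw W0 Ymu Wmu; have Lu := regular_unitmx regK hw.
apply/eigenvalueP; exists (star (toC (resolv w K W))); last first.
  by rewrite star_eq0 toC_eq0 regK.
rewrite responseE !mulmxA -starM toC_resolv mulKmx //.
rewrite -(weight_sym K) -star_cmx -starM -toC_mulmx.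
rewrite (maximizer_critical Ymu Wmu) toCZ toC_resolv_adj starZ_real starM starK.
by rewrite toC_resolv -scalemxAl mulmxK.
Qed.

(** Frequencies times the unit sphere, the latter cut out of the closed unit ball by 1 <= |W|^2 to
    inherit its compactness. *)
Definition freq_sphere : set (R * 'M[R]_(nx, 2)) :=
  `[0, 2 * pi]%classic `*` (frob_ball 0 1 `&` [set W | 1 <= frob_dot W W]).

Lemma compact_freq_sphere : compact freq_sphere.
Proof.
apply: compact_setX; first exact: segment_compact.
apply: compact_closedI; first exact: compact_frob_ball.
change (closed ((fun W : 'M[R]_(nx, 2) => frob_dot W W)
                  @^-1` [set x : R | 1 <= x])).
apply: closed_comp; last exact: closed_ge.
by move=> W _; apply: cvg_continuous => F FF FW; exact: frob_dot_cvg.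
Qed.

Lemma freq_sphereP w W : freq_sphere (w, W) -> 0 <= w <= 2 * pi /\ W != 0.
Proof.
move=> [/= + [_ /=]]; rewrite in_itv /= -frob_dot_gt0 => hw W1; split=> //.
exact: lt_le_trans W1.
Qed.

Lemma freq_sphere_normalize w W : 0 <= w <= 2 * pi -> W != 0 ->
  freq_sphere (w, (frob W)^-1 *: W).
Proof.
rewrite -frob_gt0 => hw W0; split; first by rewrite /= in_itv.
have W1 : frob ((frob W)^-1 *: W) = 1.
  by rewrite frobZ gtr0_norm ?invr_gt0 // mulVf ?gt_eqF.
by split; rewrite /frob_ball /= ?subr0 -?sqr_frob W1 // expr1n.
Qed.

Lemma freq_sphere_homogeneous K mu :
  (forall w W, freq_sphere (w, W) -> costN W K <= mu * costD w W K) ->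
  forall w Y, 0 <= w <= 2 * pi -> costN Y K <= mu * costD w Y K.
Proof.
move=> Cmu w Y hw; have [->|Y0] := eqVneq Y 0.
  by rewrite -[0](scale0r (0 : 'M[R]_(nx, 2))) costNZ costDZ expr0n !mul0r mulr0.
have := Cmu _ _ (freq_sphere_normalize hw Y0); rewrite costNZ costDZ mulrCA.
by rewrite ler_pM2l // exprn_gt0 // invr_gt0 frob_gt0.
Qed.

Lemma costN_cvg (T : Type) (F : set_system T) (Wt : T -> 'M[R]_(nx, 2))
    (Kt : T -> 'M[R]_(nu, nx)) W K :
  Filter F -> Wt t @[t --> F] --> W -> Kt t @[t --> F] --> K ->
  costN (Wt t) (Kt t) @[t --> F] --> costN W K.
Proof.
move=> FF cW cK; have cKW := mulmx_cvg FF cK cW.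
apply: cvgD; apply: frob_dot_cvg => //; apply: mulmx_cvg => //; exact: cvg_cst.
Qed.

Lemma costD_cvg (T : Type) (F : set_system T) (wt : T -> R)
    (Wt : T -> 'M[R]_(nx, 2)) (Kt : T -> 'M[R]_(nu, nx)) w W K :
  Filter F -> wt t @[t --> F] --> w -> Wt t @[t --> F] --> W ->
  Kt t @[t --> F] --> K ->
  costD (wt t) (Wt t) (Kt t) @[t --> F] --> costD w W K.
Proof.
move=> FF cw cW cK.
have cL : resolv (wt t) (Kt t) (Wt t) @[t --> F] --> resolv w K W.
  rewrite /resolv; apply: addmx_cvg.
    apply: addmx_cvg; apply: scalemx_cvg => //.
    - exact: (cvg_comp wt cos cw (@continuous_cos R w)).
    - exact: (cvg_comp wt sin cw (@continuous_sin R w)).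
    - by apply: mulmx_cvg => //; exact: cvg_cst.
  apply: oppmx_cvg; apply: mulmx_cvg => //; apply: addmx_cvg.
    exact: cvg_cst.
  by apply: oppmx_cvg; apply: mulmx_cvg => //; exact: cvg_cst.
exact: frob_dot_cvg.
Qed.

(** * Attainment of the cost and its upper semicontinuity *)

Lemma Hinf_cost_ge0 K : 0 <= J K.
Proof.
rewrite /Hinf_cost; set S := (X in sup X).
(* Without a supremum, [sup] takes the default value 0. *)
have [[S0 S1]|/sup_out ->//] := pselect (has_sup S).
have [x Sx] := S0; apply: (@le_trans _ _ x); last exact: ub_le_sup.
by case: Sx => w _ <-; exact: sqrtr_ge0.
Qed.

Lemma response_spectrum_ub w K mu : regular K -> 0 <= w <= 2 * pi ->
  (forall Y, costN Y K <= mu * costD w Y K) ->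
  ubound [set complex.Re z | z in [set z : C | eigenvalue (response w K) z]] mu.
Proof.
move=> regK hw Ymu _ [z /= zM <-].
have [W W0 NW] := eigenvalue_quotient regK hw zM.
by have := Ymu W; rewrite NW ler_pM2r // regular_costD_gt0.
Qed.

Lemma lambda_max_le w K mu : regular K -> 0 <= w <= 2 * pi -> 0 <= mu ->
  (forall Y, costN Y K <= mu * costD w Y K) -> lambda_max (response w K) <= mu.
Proof.
move=> regK hw mu0 Ymu; have ub := response_spectrum_ub regK hw Ymu.
rewrite /lambda_max; set S := (X in sup X).
(* The [sup] of an empty set is 0, which is where 0 <= mu enters. *)
have [S0|/set0P S0] := eqVneq S set0; first by rewrite S0 sup0.
exact: ge_sup.
Qed.

Lemma Hinf_cost_ub K mu : regular K -> 0 <= mu ->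
  (forall w Y, 0 <= w <= 2 * pi -> costN Y K <= mu ^+ 2 * costD w Y K) ->
  ubound [set Num.sqrt (lambda_max (response w K)) | w in `[0, 2 * pi]%classic] mu.
Proof.
move=> regK mu0 Ymu _ [w /= + <-]; rewrite in_itv /= => hw.
rewrite -[leRHS](ger0_norm mu0) -sqrtr_sqr; apply: ler_wsqrtr.
by apply: lambda_max_le => // [|Y]; [exact: sqr_ge0 | exact: Ymu].
Qed.

Lemma Hinf_cost_le K mu : regular K -> 0 <= mu ->
  (forall w Y, 0 <= w <= 2 * pi -> costN Y K <= mu ^+ 2 * costD w Y K) ->
  J K <= mu.
Proof.
move=> regK mu0 /(Hinf_cost_ub regK mu0) ub; apply: ge_sup => //.
exists (Num.sqrt (lambda_max (response 0 K))); exists 0 => //=.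
by rewrite in_itv /= lexx mulr_ge0 // pi_ge0.
Qed.

(** The quotient is continuous on the compact [freq_sphere]. Its maximum mu is an eigenvalue of the
    response at the maximising frequency and bounds the real part of every eigenvalue at any
    frequency, so J K is the square root of mu. *)
Lemma Hinf_cost_attained K : (0 < nx)%N -> regular K ->
  exists w W, [/\ 0 <= w <= 2 * pi, W != 0, costN W K = J K ^+ 2 * costD w W K &
    forall w' Y, 0 <= w' <= 2 * pi -> costN Y K <= J K ^+ 2 * costD w' Y K].
Proof.
move=> nx0 regK.
have [[w W] /set_mem wW max] : exists2 c, c \in freq_sphere &
    forall t, t \in freq_sphere ->
      costN t.2 K / costD t.1 t.2 K <= costN c.2 K / costD c.1 c.2 K.
  apply: (@compact_EVT_max _ _ (fun t => costN t.2 K / costD t.1 t.2 K)).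
  - have W0 : const_mx 1 != 0 :> 'M[R]_(nx, 2).
      apply/eqP => /matrixP/(_ (Ordinal nx0) 0); rewrite !mxE => /eqP.
      by rewrite oner_eq0.
    eexists; apply: (@freq_sphere_normalize 0) W0.
    by rewrite lexx mulr_ge0 // pi_ge0.
  - exact: compact_freq_sphere.
  - apply: continuous_in_subspaceT => -[w W] /set_mem /freq_sphereP[hw W0].
    apply: cvg_continuous => F FF Ft.
    have c1 : t.1 @[t --> F] --> w by exact: (cvg_comp id fst Ft cvg_fst).
    have c2 : t.2 @[t --> F] --> W by exact: (cvg_comp id snd Ft cvg_snd).
    apply: cvgM; first by apply: costN_cvg => //; exact: cvg_cst.
    apply: cvgV; first by rewrite gt_eqF // regular_costD_gt0.
    by apply: costD_cvg => //; exact: cvg_cst.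
have [hw W0] := freq_sphereP wW.
have Dgt := regular_costD_gt0 regK hw W0.
set mu := costN W K / costD w W K in max.
have mu0 : 0 < mu by rewrite divr_gt0 // costN_gt0.
have Wmu : costN W K = mu * costD w W K by rewrite /mu mulfVK ?gt_eqF.
have Ymu : forall w' Y, 0 <= w' <= 2 * pi -> costN Y K <= mu * costD w' Y K.
  apply: freq_sphere_homogeneous => w' Y wY; have [hw' Y0] := freq_sphereP wY.
  by rewrite -ler_pdivrMr ?regular_costD_gt0 //; apply: (max (w', Y)); rewrite inE.
have smu : Num.sqrt mu ^+ 2 = mu by rewrite sqr_sqrtr // ltW.
have Ysmu w' Y : 0 <= w' <= 2 * pi ->
    costN Y K <= Num.sqrt mu ^+ 2 * costD w' Y K by rewrite smu; exact: Ymu.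
have Jmu : J K = Num.sqrt mu.
  apply: le_anti; rewrite Hinf_cost_le ?sqrtr_ge0 //=.
  apply: (@le_trans _ _ (Num.sqrt (lambda_max (response w K)))).
    apply: ler_wsqrtr; apply: ub_le_sup.
      by exists mu; apply: response_spectrum_ub => // Y; exact: Ymu.
    exists (mu%:C)%C => //=; apply: maximizer_eigenvalue W0 _ Wmu => // Y.
    exact: Ymu.
  apply: ub_le_sup; last by exists w => //=; rewrite in_itv.
  by exists (Num.sqrt mu); apply: Hinf_cost_ub; rewrite ?sqrtr_ge0.
by exists w, W; rewrite Jmu smu; split.
Qed.

Lemma Hinf_cost_gt0 K : (0 < nx)%N -> regular K -> 0 < J K.
Proof.
move=> nx0 regK; have [w [W [hw W0 NW _]]] := Hinf_cost_attained nx0 regK.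
rewrite lt0r Hinf_cost_ge0 andbT; apply/eqP => J0.
by have := costN_gt0 K W0; rewrite NW J0 expr0n mul0r ltxx.
Qed.

(** Compactness of [freq_sphere] turns the strict inequality N < g^2 D, open in (w, W, K), into one
    valid on the whole sphere for all K' near K. *)
Lemma near_Hinf_cost_le K g : (0 < nx)%N -> regular K -> J K < g ->
  \forall K' \near K, regular K' /\ J K' <= g.
Proof.
move=> nx0 regK Jg.
have J0 := Hinf_cost_ge0 K; have g0 : 0 < g by exact: le_lt_trans Jg.
have [_ [_ [_ _ _ Kmax]]] := Hinf_cost_attained nx0 regK.
have := (compact_near_coveringP freq_sphere).1 compact_freq_sphere
  'M[R]_(nu, nx) (nbhs K)
  (fun K' t => costN t.2 K' < g ^+ 2 * costD t.1 t.2 K') (nbhs_filter K).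
have cov : forall t, freq_sphere t -> \forall t' \near t & K' \near K,
    costN t'.2 K' < g ^+ 2 * costD t'.1 t'.2 K'.
  move=> [w W] /freq_sphereP[hw W0].
  pose f (p : (R * 'M[R]_(nx, 2)) * 'M[R]_(nu, nx)) :=
    g ^+ 2 * costD p.1.1 p.1.2 p.2 - costN p.1.2 p.2.
  have f0 : 0 < f ((w, W), K).
    rewrite subr_gt0 /=; apply: le_lt_trans (Kmax w W hw) _.
    by rewrite ltr_pM2r ?regular_costD_gt0 // ltr_sqr ?nnegrE // ltW.
  have cf : {for ((w, W), K), continuous f}.
    apply: cvg_continuous => F FF Ft.
    have c1 : t.1 @[t --> F] --> (w, W) by exact: (cvg_comp id fst Ft cvg_fst).
    have c2 : t.2 @[t --> F] --> K by exact: (cvg_comp id snd Ft cvg_snd).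
    have c11 : t.1.1 @[t --> F] --> w by exact: (cvg_comp _ fst c1 cvg_fst).
    have c12 : t.1.2 @[t --> F] --> W by exact: (cvg_comp _ snd c1 cvg_snd).
    apply: cvgB; last exact: costN_cvg.
    by apply: cvgM; [exact: cvg_cst | exact: costD_cvg].
  have [[U V] /= UV fUV] := cvgr_gt _ cf _ f0.
  exists (U, V) => //= -[t' K'] UVt; have := fUV (t', K') UVt.
  by rewrite /f /= subr_gt0.
move=> /(_ cov); apply: filterS => K' K'g.
(* From 0 < N < g^2 D the denominator cannot vanish, so regularity comes with the bound. *)
have regK' : regular K'.
  move=> w W hw W0; rewrite -frob_dot_gt0.
  have U := freq_sphere_normalize hw W0; have [_ U0] := freq_sphereP U.
  have /= := K'g _ U; have := costN_gt0 K' U0.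
  rewrite costNZ costDZ => N0 /(lt_trans N0).
  by rewrite mulrCA !pmulr_rgt0 // ?exprn_gt0 // invr_gt0 frob_gt0.
split; first exact: regK'.
apply: Hinf_cost_le; [exact: regK' | exact: ltW |].
by apply: freq_sphere_homogeneous => w W wW; exact: ltW (K'g _ wW).
Qed.

(** * Quadratic models of numerator and denominator, and regularity of the cost *)

Lemma costN_quad_model W K :
  quad_model (costN W) K ((Rm + Rm^T) *m (K *m W) *m W^T).
Proof.
exists (frob Rm * frob_dot W W).
  by rewrite mulr_ge0 ?frob_ge0 ?frob_dot_ge0.
move=> H _; rewrite /costN mulmxDl.
(* N is a quadratic polynomial in K, so the error is exactly its purely quadratic part. *)
rewrite (_ : _ - _ - _ = frob_dot (H *m W) (Rm *m (H *m W))); last first.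
  rewrite (frob_dot_mulmxr W^T) trmxK; move: (K *m W) (H *m W) => P Z.
  rewrite mulmxDr mulmxDl !(frob_dotDr, frob_dotDl) (frob_dot_mulmxl Rm^T) trmxK.
  by rewrite (frob_dotC Z (Rm *m P)); ring.
apply: le_trans (norm_frob_dot _ _) _.
have HW := frob_dot_mulmx_le H W; set Z := H *m W in HW *.
apply: (@le_trans _ _ (frob Rm * frob_dot Z Z)); last first.
  by rewrite -mulrA ler_wpM2l ?frob_ge0 // mulrC.
rewrite -sqr_frob expr2 mulrCA ler_wpM2l ?frob_ge0 //.
rewrite -ler_sqr ?nnegrE ?mulr_ge0 ?frob_ge0 // exprMn !sqr_frob.
exact: frob_dot_mulmx_le.
Qed.

Lemma costD_quad_model w W K :
  quad_model (costD w W) K (2 *: (B^T *m resolv w K W *m W^T)).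
Proof.
exists (frob_dot B B * frob_dot W W); first by rewrite mulr_ge0 ?frob_dot_ge0.
move=> H _; rewrite /costD.
(* The pencil is affine in K, so D is quadratic as well. *)
have -> : resolv w (K + H) W = resolv w K W + B *m (H *m W).
  rewrite /resolv mulmxDr (_ : A - (_ + _) = A - B *m K - B *m H); last first.
    by rewrite opprD addrA.
  rewrite [(_ - B *m H) *m W]mulmxBl.
  by rewrite opprD opprK addrA mulmxA.
rewrite (_ : _ - _ - _ = frob_dot (B *m (H *m W)) (B *m (H *m W))); last first.
  rewrite frob_dotZl (frob_dot_mulmxr W^T) (frob_dot_mulmxl B^T) !trmxK.
  move: (resolv w K W) (B *m (H *m W)) => L Z; rewrite !(frob_dotDr, frob_dotDl).
  by rewrite (frob_dotC Z L); ring.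
rewrite ger0_norm ?frob_dot_ge0 //.
apply: le_trans (frob_dot_mulmx_le _ _) _; rewrite -mulrA ler_wpM2l ?frob_dot_ge0 //.
by rewrite mulrC frob_dot_mulmx_le.
Qed.

Lemma dist_lt_half (x y e : R) :
  0 < e -> y <= x + e / 2 -> x - e / 2 < y -> `|x - y| < e.
Proof. by move=> *; rewrite ltr_norml; apply/andP; split; lra. Qed.

(** A quotient active at K gives N <= J^2 D near K with equality at K. This yields lower
    semicontinuity and, by [touched_above_gradient], the gradient; upper semicontinuity is
    [near_Hinf_cost_le]. *)
Lemma Hinf_cost_touch_regular K : (0 < nx)%N -> regular K -> touch_regular_at J K.
Proof.
move=> nx0 regK; have J0 := Hinf_cost_gt0 nx0 regK.
have [w [W [hw W0 NW _]]] := Hinf_cost_attained nx0 regK.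
have Dgt := regular_costD_gt0 regK hw W0.
have near_ge : \forall K' \near K, costN W K' <= J K' ^+ 2 * costD w W K'.
  have : J K < J K + 1 by rewrite ltrDl.
  move=> /(near_Hinf_cost_le nx0 regK); apply: filterS => K' [regK' _].
  by have [_ [_ [_ _ _ ->]]] := Hinf_cost_attained nx0 regK'.
split.
  apply: cvg_continuous => F FF FK; apply/cvgrPdist_lt => e e0.
  have ub : \forall K' \near K, J K' <= J K + e / 2.
    have : J K < J K + e / 2 by rewrite ltrDl divr_gt0.
    by move=> /(near_Hinf_cost_le nx0 regK); apply: filterS => K' [].
  (* Cut off at 0 so that a < J K' can be tested on squares. *)
  pose a := Num.max 0 (J K - e / 2).
  have a0 : 0 <= a by rewrite le_max lexx.
  have aJ : a < J K by rewrite gt_max J0 gtrBl divr_gt0.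
  pose f K' := costN W K' - a ^+ 2 * costD w W K'.
  have lb : \forall K' \near K, 0 < f K'.
    have cf : {for K, continuous f}.
      apply: cvg_continuous => F' FF' FK'.
      apply: cvgB; first by apply: costN_cvg => //; exact: cvg_cst.
      by apply: cvgM; [exact: cvg_cst | apply: costD_cvg => //; exact: cvg_cst].
    apply: (cvgr_gt _ cf).
    by rewrite subr_gt0 NW ltr_pM2r // ltr_sqr ?nnegrE // ltW.
  have ubF : \forall K' \near F, J K' <= J K + e / 2 := FK _ ub.
  have lbF : \forall K' \near F, 0 < f K' := FK _ lb.
  have geF : \forall K' \near F, costN W K' <= J K' ^+ 2 * costD w W K' :=
    FK _ near_ge.
  apply: filterS3 ubF lbF geF => K' h1; rewrite subr_gt0 => h2 h3.
  have h4 : a < J K'.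
    rewrite ltNge; apply/negP => Ja; move: (lt_le_trans h2 h3).
    by rewrite ltNge ler_wpM2r ?costD_ge0 // ler_sqr ?nnegrE ?Hinf_cost_ge0.
  have h5 : J K - e / 2 <= a by rewrite le_max lexx orbT.
  exact: dist_lt_half e0 h1 (le_lt_trans h5 h4).
move=> G C' s s0 JU; have [r r0 rJ] := near_frob near_ge.
apply: (touched_above_gradient (costN_quad_model W K) (costD_quad_model w W K)
  J0 Dgt NW r0 _ s0 JU) => H Hr; split; first exact: Hinf_cost_ge0.
by apply: rJ; rewrite [K + H]addrC addrK.
Qed.

End HinfCost.

(** * Summation of the decrease and the convergence rate *)

Lemma descent_average (R : realType) (a f : nat -> R) (d lb : R) (N : nat) :
  0 < d -> (forall n, a n.+1 <= a n - f n * d) -> (forall n, lb <= a n) ->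
  exists2 n : nat, (n <= N)%N & f n <= (a 0%N - lb) / (N.+1%:R * d).
Proof.
move=> d0 step alb; set q := _ / _.
have qE : (N%:R + 1) * (q * d) = a 0%N - lb.
  rewrite natr1 mulrCA /q mulfVK //.
  by rewrite mulf_neq0 ?gt_eqF.
(* If every f n with n <= N exceeded q, then N + 1 steps would lower a by more than a 0 - lb. *)
have [//|noN] := pselect (exists2 n : nat, (n <= N)%N & f n <= q).
have fq n : (n <= N)%N -> q * d < f n * d.
  by move=> nN; rewrite ltr_pM2r // ltNge; apply/negP => fn; apply: noN; exists n.
have ak k : (k <= N)%N -> a k <= a 0%N - k%:R * (q * d).
  elim: k => [|k IH] kN; first by rewrite mul0r subr0.
  have := IH (ltnW kN); have := step k; have := fq k (ltnW kN); rewrite -natr1; lra.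
have := ak N (leqnn N); have := step N; have := fq N (leqnn N).
by have := alb N.+1; lra.
Qed.

(** For Y outside T, |X - Y| would be one of the distances defining [set_dist], yet at most d. *)
Lemma set_dist_ball (R : realType) m n (S T : set 'M[R]_(m, n)) d X Y :
  (d%:E < set_dist S (~` T))%E -> S X -> frob (Y - X) <= d -> T Y.
Proof.
move=> dST SX YX; apply: contrapT => nTY.
have : (set_dist S (~` T) <= (frob (X - Y))%:E)%E.
  by apply: ereal_inf_lbound; exists X, Y.
rewrite -opprB frobN => /(lt_le_trans dST).
by rewrite lte_fin ltNge YX.
Qed.

Theorem theorem3 (R : realType) (nx nu : nat)
  (A : 'M[R]_nx) (B : 'M[R]_(nx, nu)) (Q : 'M[R]_nx) (Rm : 'M[R]_nu)
  (hQ : sym_posdef Q) (hR : sym_posdef Rm) (hAB : stabilizable A B)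
  (K0 : 'M[R]_(nu, nx)) (hK0 : stab_set A B K0)
  (hD0 : (0 < set_dist (sublevel (stab_set A B) (Hinf_cost A B Q Rm)
                          (Hinf_cost A B Q Rm K0))
                       (~` stab_set A B))%E)
  (delta : R) (hdelta0 : 0 < delta)
  (hdelta : (delta%:E < set_dist (sublevel (stab_set A B) (Hinf_cost A B Q Rm)
                                    (Hinf_cost A B Q Rm K0))
                                 (~` stab_set A B))%E)
  (K F : nat -> 'M[R]_(nu, nx))
  (hK_0 : K 0%N = K0)
  (hF : forall n, min_norm_elt (goldstein_subdiff (Hinf_cost A B Q Rm) delta (K n)) (F n))
  (hK_step : forall n, K n.+1 = K n - (delta / frob (F n)) *: F n) :
  let J := Hinf_cost A B Q Rm in
  let Jstar := inf (J @` stab_set A B) in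
  (forall n, stab_set A B (K n)) /\
  (forall N : nat, exists2 n : nat, (n <= N)%N &
     frob (F n) <= (J K0 - Jstar) / (N.+1%:R * delta)) /\
  (forall eps : R, 0 < eps -> forall N : nat,
     J K0 - Jstar <= N.+1%:R * delta * eps ->
     exists2 n : nat, (n <= N)%N &
       frob (F n) <= eps /\ stationary J delta eps (K n)).
Proof.
move=> J Jstar.
have ball n X : sublevel (stab_set A B) J (J K0) (K n) ->
    frob (X - K n) <= delta -> stab_set A B X by exact: set_dist_ball hdelta.
have step n : sublevel (stab_set A B) J (J K0) (K n) ->
    J (K n.+1) <= J (K n) - frob (F n) * delta.
  (* For nx = 0 all iterates and subgradients are 0 and the claim is trivial; otherwise the cost is
     attained. *)
  move=> Kn; have [nx0|nx0] := posnP nx.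
    have thin (X : 'M[R]_(nu, nx)) : X = 0.
      by apply/matrixP => i [j jnx]; exfalso; rewrite nx0 in jnx.
    by rewrite [K n.+1]thin [K n]thin [F n]thin frob0 mul0r subr0.
  rewrite hK_step; apply: goldstein_descent => // X XK.
  by apply: Hinf_cost_touch_regular => //; exact/stab_regular/(ball _ _ Kn XK).
(* The decrease keeps the iterate in the sublevel set, and a step of length at most delta from that
   set stays stabilizing. *)
have inv n : sublevel (stab_set A B) J (J K0) (K n).
  elim: n => [|n IH]; first by rewrite hK_0; split.
  split; last first.
    have [_ JKn] := IH; apply: le_trans (step n IH) _; apply: le_trans JKn.
    by rewrite gerBl mulr_ge0 ?frob_ge0 // ltW.
  apply: (ball n _ IH); rewrite hK_step addrAC subrr add0r frobN frobZ.
  have [->|F0] := eqVneq (frob (F n)) 0; first by rewrite mulr0 ltW.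
  by rewrite ger0_norm ?mulfVK // divr_ge0 ?frob_ge0 // ltW.
(* Makes the [inf] in [Jstar] a genuine lower bound and not a default value. *)
have lb : has_lbound (J @` stab_set A B).
  by exists 0 => _ [X _ <-]; exact: Hinf_cost_ge0.
have rate N : exists2 n : nat, (n <= N)%N &
    frob (F n) <= (J K0 - Jstar) / (N.+1%:R * delta).
  rewrite -hK_0; apply: (descent_average (a := J \o K)) => // n /=.
    exact: step.
  by apply: (ge_inf lb); exists (K n); first by case: (inv n).
split; first by move=> n; case: (inv n).
split=> // eps eps0 N Neps; have [n nN Fn] := rate N.
have Feps : frob (F n) <= eps.
  apply: le_trans Fn _; rewrite ler_pdivrMr ?mulr_gt0 ?ltr0Sn //.
  by rewrite [eps * _]mulrC.
(* [F n] lies in the Goldstein subdifferential, so its norm bounds the infimum in [stationary]. *)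
exists n => //; split=> //; apply: le_trans Feps; apply: ge_inf.
  by exists 0 => _ [G _ <-]; exact: frob_ge0.
by exists (F n) => //; case: (hF n).
Qed.
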